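(* Let $H=L^2(\mathcal O)$ and assume that $\mathrm e^{sA}$ is positivity preserving for every $s\ge0$ (i.e. $x\in H$, $x\ge0$ implies $\mathrm e^{sA}x\ge0$). Let $0\le t<T$. Let $\mathfrak b:\Omega\times[t,T]\times\mathbb R\to\mathbb R$ be $\mathrm{Prog}_{[t,T]}\otimes\mathscr B(\mathbb R)/\mathscr B(\mathbb R)$ measurable and let there be a constant $C_L$ such that (suppressing the variable $\omega$) $$|\mathfrak b(s,\mathrm x_1)-\mathfrak b(s,\mathrm x_2)|\le C_L|\mathrm x_1-\mathrm x_2|\quad\text{for all }s\in[t,T],\ \mathrm x_1,\mathrm x_2\in\mathbb R.$$ Assume $\mathfrak b(\cdot,0)\in L^1(t,T)$ $\mathbb P$-almost surely. Let $b$ denote the Nemytskii operator associated with $\mathfrak b$, that is $b(s,x)(\xi):=\mathfrak b(s,x(\xi))$ for $s\in[t,T]$, $x\in H$, $\xi\in\mathcal O$. Let $f_1,f_2:\Omega\times[t,T]\to H$ be $\mathrm{Prog}_{[t,T]}/\mathscr B(H)$ measurable with $f_1,f_2\in L^1(t,T;H)$ $\mathbb P$-almost surely, and let $\sigma:\Omega\times[t,T]\to L_2(\Xi,H)$ be $\mathrm{Prog}_{[t,T]}/\mathscr B(L_2(\Xi,H))$ measurable with $\sigma\in L^2(t,T;L_2(\Xi,H))$ $\mathbb P$-almost surely. For $i=1,2$ let $X_i$ be a mild solution of $$\mathrm dX(s)=[AX(s)+b(s,X(s))+f_i(s)]\mathrm ds+\sigma(s)\mathrm dW(s),\ s\in[t,T],\qquad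 X(t)=x_i\in L^2(\mathcal O).$$ Suppose that $x_1\ge x_2$ and $f_1(s)\ge f_2(s)$ for $s\in[t,T]$. Then $X_1(s)\ge X_2(s)$ for all $s\in[t,T]$.
   Context: $\mathcal O\subset\mathbb R^d$, $d\in\mathbb N$, is a domain. For $x_1,x_2\in L^2(\mathcal O)$, $x_1\le x_2$ is understood almost everywhere. Inequalities between random elements of $H$ are understood $\mathbb P$-a.s. $A:\mathcal D(A)\subset H\to H$ is linear, densely defined and maximal dissipative and generates the $C_0$-semigroup of contractions $(\mathrm e^{sA})_{s\ge0}$. $\Xi$ is a real separable Hilbert space, $L_2(\Xi,H)$ the Hilbert--Schmidt operators, $W$ a cylindrical Wiener process in $\Xi$ on a complete probability space $(\Omega,\mathscr F,\mathbb P)$ with $W(t)=0$ a.s., with filtration $(\mathscr F^t_s)_{s\in[t,T]}$ generated by $W$ and the $\mathbb P$-null sets. $\mathrm{Prog}_{[t,T]}$ is the $\sigma$-field of progressively measurable subsets of $\Omega\times[t,T]$, and $\mathscr B(\cdot)$ denotes Borel $\sigma$-fields. A mild solution is an $H$-valued progressively measurable process $X$ such that for every $s\in[t,T]$, $\mathbb P$-a.s., $\int_t^s\big(\|X(r)\|_H+\|\mathrm e^{(s-r)A}(b(r,X(r))+f_i(r))\|_H+\|\mathrm e^{(s-r)A}\sigma(r)\|_{L_2(\Xi,H)}^2\big)\mathrm dr<\infty$ and $X(s)=\mathrm e^{(s-t)A}x_i+\int_t^s\mathrm e^{(s-r)A}(b(r,X(r))+f_i(r))\mathrm dr+\int_t^s\mathrm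 e^{(s-r)A}\sigma(r)\mathrm dW(r)$. The operator $b$ is understood as a map with values in $H$. *)

(* Defs.v *)
From HB Require Import structures.
From mathcomp Require Import all_boot all_order all_algebra.
From mathcomp Require Import generic_quotient ring_quotient.
From mathcomp Require Import all_classical all_reals all_analysis.
From mathcomp Require Import measurable_realfun.
Set Implicit Arguments.
Unset Strict Implicit.
Unset Printing Implicit Defensive.
Import Order.TTheory GRing.Theory Num.Theory.
Import numFieldNormedType.Exports.
Local Open Scope classical_set_scope.
Local Open Scope ring_scope.
Local Open Scope quotient_scope.

HB.mixin Record isInnerProduct (R : realType) V & NormedModule R V := {
  dot : V -> V -> R;
  dotC : forall u v, dot u v = dot v u;
  dotDZl : forall (a : R) u v w, dot (a *: u + v) w = a * dot u w + dot v w;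
  dotvv : forall u, dot u u = `|u| ^+ 2 }.
#[short(type="preHilbertType")]
HB.structure Definition PreHilbert (R : realType) :=
  {V of NormedModule R V & isInnerProduct R V}.
#[short(type="hilbertType")]
HB.structure Definition Hilbert (R : realType) :=
  {V of CompleteNormedModule R V & isInnerProduct R V}.

Section L2.
Context d (T : measurableType d) (R : realType).
Variable mu : {measure set T -> \bar R}.
Notation L2fun := (LfunType mu (lee1n 2)).

(* L^2(mu): square-integrable functions modulo equality mu-almost everywhere,
   with the library's L^2 norm and the inner product (x, y) |-> \int x y dmu. *)
Definition ae_null : {pred L2fun} :=
  fun f => `[< {ae mu, forall x, (f : T -> R) x = 0} >].

Lemma ae_null_closed : zmod_closed ae_null.
Proof.
split; first by apply/asboolP; apply/nearW.
move=> f g /asboolP f0 /asboolP g0; apply/asboolP.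
apply: filterS2 f0 g0 => x fx gx; change ((f : T -> R) x - (g : T -> R) x = 0).
by rewrite fx gx subr0.
Qed.
HB.instance Definition _ := GRing.isZmodClosed.Build _ ae_null ae_null_closed.

Definition L2 : Type := Quotient.quot ae_null.
HB.instance Definition _ := Choice.on L2.
HB.instance Definition _ := GRing.Zmodule.on L2.
HB.instance Definition _ := EqQuotient.on L2.

Definition L2_fun (x : L2) : T -> R := (repr x : L2fun).
Coercion L2_fun : L2 >-> Funclass.

Lemma L2_piP (f g : L2fun) :
  \pi_L2 f = \pi_L2 g <-> {ae mu, forall x, (f : T -> R) x = g x}.
Proof.
split=> [/eqP|h].
  rewrite -Quotient.idealrBE => /asboolP; apply: filterS => x fgx.
  by apply/eqP; rewrite -subr_eq0; apply/eqP.
apply/eqP; rewrite -Quotient.idealrBE; apply/asboolP; apply: filterS h => x fgx.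
by change ((f : T -> R) x - (g : T -> R) x = 0); rewrite fgx subrr.
Qed.

Lemma L2_pi_fun (f : L2fun) : {ae mu, forall x, L2_fun (\pi_L2 f) x = f x}.
Proof. by apply/L2_piP; rewrite reprK. Qed.

Lemma L2P (x y : L2) : x = y <-> {ae mu, forall t, x t = y t}.
Proof. by rewrite -L2_piP !reprK. Qed.

Lemma L2_fun0 : {ae mu, forall t, L2_fun 0 t = 0}.
Proof.
have -> : 0 = \pi_L2 (0 : L2fun) by rewrite pi_zeror.
exact: L2_pi_fun.
Qed.

Lemma L2_funD (x y : L2) : {ae mu, forall t, L2_fun (x + y) t = x t + y t}.
Proof.
have -> : x + y = \pi_L2 ((repr x : L2fun) + repr y) by rewrite pi_addr !reprK.
exact: L2_pi_fun.
Qed.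

Definition L2_scale (a : R) (x : L2) : L2 := \pi_L2 (a *: (repr x : L2fun)).

Lemma L2_funZ_subproof a (x : L2) : {ae mu, forall t, L2_scale a x t = a * x t}.
Proof. exact: L2_pi_fun. Qed.

Lemma L2_scaleA a b x : L2_scale a (L2_scale b x) = L2_scale (a * b) x.
Proof.
apply/L2P; have h1 := L2_funZ_subproof a (L2_scale b x).
have h2 := L2_funZ_subproof b x; have h3 := L2_funZ_subproof (a * b) x.
near=> t.
rewrite (near h1 t)// (near h2 t)// (near h3 t)//.
by rewrite mulrA.
Unshelve. all: by end_near. Qed.

Lemma L2_scale1 : left_id 1 L2_scale.
Proof.
move=> x; apply/L2P; have := L2_funZ_subproof 1 x.
by apply: filterS => t ->; rewrite mul1r.
Qed.

Lemma L2_scaleDr : right_distributive L2_scale +%R.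
Proof.
move=> a x y; apply/L2P.
have h1 := L2_funZ_subproof a (x + y); have h2 := L2_funD x y.
have h3 := L2_funD (L2_scale a x) (L2_scale a y).
have h4 := L2_funZ_subproof a x; have h5 := L2_funZ_subproof a y.
near=> t.
rewrite (near h1 t)// (near h2 t)// (near h3 t)// (near h4 t)// (near h5 t)//.
by rewrite mulrDr.
Unshelve. all: by end_near. Qed.

Lemma L2_scaleDl x : {morph L2_scale^~ x : a b / a + b}.
Proof.
move=> a b; apply/L2P.
have h1 := L2_funZ_subproof (a + b) x.
have h3 := L2_funD (L2_scale a x) (L2_scale b x).
have h4 := L2_funZ_subproof a x; have h5 := L2_funZ_subproof b x.
near=> t.
rewrite (near h1 t)// (near h3 t)// (near h4 t)// (near h5 t)//.
by rewrite mulrDl.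
Unshelve. all: by end_near. Qed.

HB.instance Definition _ := GRing.Zmodule_isLmodule.Build R L2
  L2_scaleA L2_scale1 L2_scaleDr L2_scaleDl.

Lemma L2_funZ a (x : L2) : {ae mu, forall t, L2_fun (a *: x) t = a * x t}.
Proof. exact: L2_funZ_subproof. Qed.

Definition L2_norm (x : L2) : R := fine ('N[mu]_2%:E[EFin \o (x : T -> R)]).

Definition L2_dot (x y : L2) : R := \int[mu]_t (x t * y t).

Lemma L2_integrable (x y : L2) :
  mu.-integrable setT (EFin \o (fun t => x t * y t)).
Proof.
apply/Lfun1_integrable; apply: Lfun2_mul_Lfun1; exact: LfunP.
Qed.

Lemma L2_dotC x y : L2_dot x y = L2_dot y x.
Proof. by apply: eq_Rintegral => t _; rewrite mulrC. Qed.


Lemma L2_dotDZl (a : R) (x y z : L2) :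
  L2_dot (a *: x + y) z = a * L2_dot x z + L2_dot y z.
Proof.
rewrite /L2_dot -RintegralZl//; last exact: L2_integrable.
have iax : mu.-integrable setT (EFin \o (fun t => a * (x t * z t))).
  rewrite (_ : _ \o _ = fun t => (a%:E * (x t * z t)%:E)%E) //.
  by apply: integrableZl => //; exact: L2_integrable.
rewrite -RintegralD//; last exact: L2_integrable.
congr fine; apply: ae_eq_integral => //.
- by have /integrableP[] := L2_integrable (a *: x + y) z.
- have /integrableP[mx _] := iax; have /integrableP[my _] := L2_integrable y z.
  by apply/measurable_EFinP; apply: measurable_funD; exact/measurable_EFinP.
have h1 := L2_funD (a *: x) y; have h2 := L2_funZ a x.
apply: filterS2 h1 h2 => t /= -> -> _.
by rewrite mulrDl mulrA.
Qed.

Lemma L2_norm_pi (f : L2fun) :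
  L2_norm (\pi_L2 f) = fine ('N[mu]_2%:E[EFin \o (f : T -> R)]).
Proof.
have mabs (g : L2fun) : measurable_fun setT (fun t => (`|(g t)%:E| `^ 2)%E).
  apply: (measurableT_comp (measurable_poweR _)) => //.
  by apply: measurableT_comp => //; exact/measurable_EFinP.
rewrite /L2_norm; congr fine.
rewrite unlock /Lnorm; congr (_ `^ _)%E.
apply: ae_eq_integral => //; [exact: mabs|exact: mabs|].
by apply: filterS (L2_pi_fun f) => t /= ->.
Qed.

Lemma L2_normE (x : L2) :
  (L2_norm x)%:E = 'N[mu]_2%:E[EFin \o (repr x : L2fun)]%E.
Proof. exact: (finite_norm_fine (repr x : L2fun)). Qed.

Lemma ler_L2_normD (x y : L2) : L2_norm (x + y) <= L2_norm x + L2_norm y.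
Proof.
have -> : x + y = \pi_L2 ((repr x : L2fun) + repr y) by rewrite pi_addr !reprK.
rewrite L2_norm_pi; exact: ler_LnormD.
Qed.

Lemma L2_normZ a (x : L2) : L2_norm (a *: x) = `|a| * L2_norm x.
Proof.
rewrite (L2_norm_pi (a *: (repr x : L2fun))).
rewrite -[RHS]/(fine (`|a| * L2_norm x)%:E) EFinM L2_normE.
by congr fine; exact: (LnormZ (repr x : L2fun) a).
Qed.

Lemma L2_norm_eq0 (x : L2) : L2_norm x = 0 -> x = 0.
Proof.
move=> /fine_Lnormr_eq0 x0; apply/L2P.
by apply: filterS2 x0 L2_fun0 => t /= + ->; apply.
Qed.

HB.instance Definition _ := @Lmodule_isNormed.Build R L2
  L2_norm ler_L2_normD L2_normZ L2_norm_eq0.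

Lemma L2_dotvv (x : L2) : L2_dot x x = `|x| ^+ 2.
Proof.
apply: EFin_inj; rewrite -powR_mulrn// -poweR_EFin [Num.norm x]/(L2_norm x).
rewrite L2_normE powR_Lnorm ?pnatr_eq0// /L2_dot /Rintegral fineK.
  apply: eq_integral => t _.
  by rewrite abse_EFin poweR_EFin powR_mulrn// real_normK ?num_real.
by apply: integrable_fin_num => //; exact: L2_integrable.
Qed.

HB.instance Definition _ := @isInnerProduct.Build R L2
  L2_dot L2_dotC L2_dotDZl L2_dotvv.

Definition L2_le (x y : L2) := {ae mu, forall t, x t <= y t}.

End L2.

Section lebesgue_measure_on.
Context (R : realType) (n : nat).
Local Open Scope ereal_scope.
Local Notation E := 'rV[R]_n.+1.

Definition box (a b : E) : set E := [set x | forall i, (a ord0 i <= x ord0 i < b ord0 i)%R].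

Definition box_volume (a b : E) : \bar R := (\prod_i (b ord0 i - a ord0 i))%:E.

Definition box_cover (X : set E) : set ((nat -> E) * (nat -> E)) :=
  [set c : (nat -> E) * (nat -> E) | (forall k i, (c.1 k ord0 i <= c.2 k ord0 i)%R) /\
           X `<=` \bigcup_k box (c.1 k) (c.2 k)].

Definition cover_volume (c : (nat -> E) * (nat -> E)) : \bar R :=
  \sum_(k <oo) box_volume (c.1 k) (c.2 k).

Definition lebesgue_outer (X : set E) : \bar R :=
  ereal_inf (cover_volume @` box_cover X).

Lemma box_volume_ge0 (a b : E) : (forall i, (a ord0 i <= b ord0 i)%R) -> 0 <= box_volume a b.
Proof.
by move=> ab; rewrite lee_fin; apply: prodr_ge0 => i _; rewrite subr_ge0.
Qed.

Lemma lebesgue_outer_ge0 X : 0 <= lebesgue_outer X.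
Proof.
apply: le_ereal_inf_tmp => _ [c [ab _] <-].
by apply: nneseries_ge0 => k _ _; exact: box_volume_ge0.
Qed.

Lemma lebesgue_outer0 : lebesgue_outer set0 = 0.
Proof.
apply/eqP; rewrite eq_le lebesgue_outer_ge0 andbT.
apply: ereal_inf_lbound; exists (fun=> 0%R, fun=> 0%R); first by split.
by apply: eseries0 => k _ _; rewrite /box_volume big_ord_recl subrr mul0r.
Qed.

Lemma le_lebesgue_outer : {homo lebesgue_outer : A B / A `<=` B >-> A <= B}.
Proof.
move=> A B AB; apply: ereal_inf_le_tmp => _ [c [ab Bc] <-].
by exists c => //; split=> //; exact: subset_trans AB Bc.
Qed.

Lemma lebesgue_outer_sigma_subadditive : sigma_subadditive lebesgue_outer.
Proof.
move=> A; have [[i ioo]|] := pselect (exists i, lebesgue_outer (A i) = +oo).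
  rewrite (eseries_pinfty _ _ ioo) ?leey// => m _.
  by rewrite -ltNye (lt_le_trans _ (lebesgue_outer_ge0 _)).
rewrite -forallNE => Aoo.
suff add2e (e : {posnum R}) :
    lebesgue_outer (\bigcup_m A m) <=
    \sum_(i <oo) lebesgue_outer (A i) + e%:num%:E.
  by apply/lee_addgt0Pr => _/posnumP[].
rewrite (le_trans _ (epsilon_trick _ _ _))//; last first.
  by move=> m; exact: lebesgue_outer_ge0.
pose P m (c : (nat -> E) * (nat -> E)) := box_cover (A m) c /\
  cover_volume c <=
  lebesgue_outer (A m) + (e%:num / (2 ^ m.+1)%:R)%:E.
have [G PG] : {G : nat -> (nat -> E) * (nat -> E) & forall m, P m (G m)}.
  apply: (@choice _ _ P) => m; rewrite /P.
  have fA : lebesgue_outer (A m) \is a fin_num.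
    by rewrite ge0_fin_numE ?lebesgue_outer_ge0// ltey; apply/eqP/Aoo.
  have e0 : (0 < e%:num / (2 ^ m.+1)%:R)%R by [].
  have [_ [c Ac <-] lec] := lb_ereal_inf_adherent e0 fA.
  by exists c; split => //; exact: ltW.
pose v (p : nat * nat) := box_volume ((G p.1).1 p.2) ((G p.1).2 p.2).
have v0 p : 0 <= v p by apply: box_volume_ge0; exact: (PG p.1).1.1.
apply: (@le_trans _ _ (\esum_(p in setT) v p)).
  apply: ereal_inf_lbound.
  have /card_esym/ppcard_eqP[f] := card_nat2.
  exists ((fun k => (G (f k).1).1 (f k).2), (fun k => (G (f k).1).2 (f k).2)).
    split=> [k i|]; first exact: (PG (f k).1).1.1.
    move=> x [i _ /(PG i).1.2[j _ xj]].
    by exists (f^-1%FUN (i, j)) => //=; rewrite invK ?inE.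
  rewrite /cover_volume /= -(esum_pred_image v f xpredT)//.
    by rewrite [fun=> _]set_true image_eq.
  by move=> i j _ _ /(congr1 f^-1%FUN); rewrite !funK ?inE.
rewrite (_ : esum _ _ = \sum_(i <oo) \sum_(j <oo) v (i, j)).
  apply: lee_nneseries => [i _|i _]; last exact: (PG i).2.
  by move=> _; apply: nneseries_ge0 => j _ _; exact: v0.
rewrite (_ : setT = \bigcup_k [set (k, j) | j in [set: nat]]); last first.
  by rewrite predeqE => -[a b]; split => // _; exists a => //; exists b.
rewrite esum_bigcupT//=.
- rewrite -(image_id [set: nat]) -fun_true esum_pred_image//; last first.
    by move=> m _; exact: esum_ge0.
  apply: eq_eseriesr => /= j _.
  rewrite -(esum_pred_image v (pair j) predT)//=; last first.
    by move=> ? ? _ _; exact: (@can_inj _ _ _ snd).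
  by rewrite image_id.
- apply/trivIsetP => i j _ _ ij.
  rewrite predeqE => -[x m] /=; split => //= -[] [_] _ [<-{x} _].
  by move=> [m' _] [] /esym/eqP; rewrite (negbTE ij).
Qed.

(* The trace on O of the Lebesgue outer measure. When O is Lebesgue measurable
   (in particular open), a set X is Caratheodory measurable for it exactly when
   X `&` O is Lebesgue measurable, so that it induces Lebesgue measure on O; a
   function on the whole space is then only seen through its values on O. *)
Definition lebesgue_on (O : set E) (X : set E) : \bar R :=
  lebesgue_outer (X `&` O).

Variable O : set E.

Lemma lebesgue_on0 : lebesgue_on O set0 = 0.
Proof. by rewrite /lebesgue_on set0I lebesgue_outer0. Qed.

Lemma lebesgue_on_ge0 X : 0 <= lebesgue_on O X.
Proof. exact: lebesgue_outer_ge0. Qed.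

Lemma le_lebesgue_on : {homo lebesgue_on O : A B / A `<=` B >-> A <= B}.
Proof. by move=> A B AB; apply: le_lebesgue_outer; exact: setSI. Qed.

Lemma lebesgue_on_sigma_subadditive : sigma_subadditive (lebesgue_on O).
Proof.
by move=> A; rewrite /lebesgue_on setI_bigcupl; exact: lebesgue_outer_sigma_subadditive.
Qed.

HB.instance Definition _ := isOuterMeasure.Build R E (lebesgue_on O)
  lebesgue_on0 lebesgue_on_ge0 le_lebesgue_on lebesgue_on_sigma_subadditive.


Definition lebesgue_outer_on : {outer_measure set E -> \bar R} := lebesgue_on O.

End lebesgue_measure_on.


Definition lebesgue_measure_on (R : realType) n (O : set 'rV[R]_n.+1) :
    {measure set (caratheodory_type (lebesgue_outer_on O)) -> \bar R} :=
  lebesgue_outer_on O.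

Notation L2_on O := (L2 (lebesgue_measure_on O)).

Section semigroup.
Context (R : realType) (H : preHilbertType R).
Implicit Types (D : set H) (A : H -> H) (S : R -> H -> H).

(* An unbounded operator is a pair of a domain D and a map A whose values
   outside D are irrelevant. *)
Definition linear_operator D A :=
  D 0 /\ forall (a : R) x y, D x -> D y ->
    D (a *: x + y) /\ A (a *: x + y) = a *: A x + A y.

Definition dissipative D A := forall x, D x -> dot (A x) x <= 0.

Definition maximal_dissipative D A :=
  dissipative D A /\
  forall D' A', linear_operator D' A' -> dissipative D' A' ->
    D `<=` D' -> (forall x, D x -> A' x = A x) -> D' `<=` D.

Definition contraction_semigroup S :=
  [/\ forall s, 0 <= s -> linear (S s),
      forall x, S 0 x = x,
      forall s r x, 0 <= s -> 0 <= r -> S (s + r) x = S s (S r x),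
      forall s x, 0 <= s -> `|S s x| <= `|x| &
      forall x, S h x @[h --> 0^'+] --> x].

Definition generates D A S :=
  forall x y, (D x /\ A x = y) <-> h^-1 *: (S h x - x) @[h --> 0^'+] --> y.

End semigroup.

Section hilbert_schmidt.
Context (R : realType) (X : hilbertType R) (H : preHilbertType R).

Definition orthonormal_basis (B : set X) :=
  [/\ forall e, B e -> dot e e = 1,
      forall e f, B e -> B f -> e <> f -> dot e f = 0 &
      forall x, (forall e, B e -> dot x e = 0) -> x = 0].

(* Squared Hilbert-Schmidt norm; it does not depend on the basis chosen. *)
Definition hs_normsq (G : X -> H) : \bar R :=
  \esum_(e in xget set0 orthonormal_basis) (`|G e| ^+ 2)%:E.

Definition hilbert_schmidt : set (X -> H) :=
  [set G | [/\ linear G, continuous G & (hs_normsq G < +oo)%E]].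

(* Open sets of hilbert_schmidt for the Hilbert-Schmidt norm. *)
Definition hs_open : set (set (X -> H)) :=
  [set U | U `<=` hilbert_schmidt /\
    forall G, U G -> exists2 e : R, 0 < e &
      forall G', hilbert_schmidt G' ->
        (hs_normsq (G' \- G)%R < (e ^+ 2)%:E)%E -> U G'].

Definition hs_borel : set (set (X -> H)) := <<s hilbert_schmidt, hs_open >>.

End hilbert_schmidt.

Section bochner.
Context (R : realType) (H : normedModType R).
(* A step function \sum_j 1_(A_j) y_j is the list of the pairs (A_j, y_j). *)
Local Notation step := (seq (set (measurableTypeR R) * H)).

Definition step_fun (l : step) (r : R) : H := \sum_(p <- l) \1_(p.1) r *: p.2.

Definition step_integral (l : step) : H :=
  \sum_(p <- l) fine (lebesgue_measure p.1) *: p.2.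

Definition is_bochner_integral (D : set R) (g : R -> H) (J : H) :=
  exists l : nat -> step,
    [/\ forall n p, p \in l n ->
          [/\ measurable p.1, p.1 `<=` D & (lebesgue_measure p.1 < +oo)%E],
        {ae lebesgue_measure, forall r, D r -> step_fun (l n) r @[n --> \oo] --> g r},
        (\int[lebesgue_measure]_(r in D) `|g r - step_fun (l n) r|%:E)%E
          @[n --> \oo] --> 0%E &
        step_integral (l n) @[n --> \oo] --> J].

End bochner.

Section sigma_fields.

(* sigma-fields on a subset D of a type are represented by sets of subsets of
   D; measurable_on only looks at the restriction of f to D. *)
Definition measurable_on (U V : Type) (D : set U) (S : set (set U))
    (S' : set (set V)) (f : U -> V) :=
  forall B, S' B -> S (D `&` f @^-1` B).

Definition borel (V : topologicalType) : set (set V) :=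
  <<s [set U : set V | open U] >>.

Definition product_sigma (U V : Type) (D : set U) (D' : set V)
    (S : set (set U)) (S' : set (set V)) : set (set (U * V)) :=
  <<s D `*` D', [set A `*` B | A in S & B in S'] >>.

End sigma_fields.

Section wiener.
Context (R : realType) (X : hilbertType R) (d : measure_display)
  (Om : measurableType d) (P : probability Om R).
Variables (W : R -> X -> Om -> R) (t T : R).

(* W s h is the real random variable <W(s), h>. *)
Definition filtration (s : R) : set (set Om) :=
  <<s [set A | exists r h B, [/\ t <= r <= s, measurable B & A = W r h @^-1` B]]
      `|` P.-negligible >>.

Definition prog : set (set (Om * R)) :=
  [set A | A `<=` setT `*` `[t, T] /\
    forall s, t <= s <= T ->
      product_sigma setT `[t, s] (filtration s)
        [set B | measurable B /\ B `<=` `[t, s]] (A `&` (setT `*` `[t, s]))].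

Definition prog_measurable (V : Type) (S' : set (set V)) (Y : Om -> R -> V) :=
  measurable_on (setT `*` `[t, T]) prog S' (fun p => Y p.1 p.2).

(* Last clause: W(s)h - W(r)h is centred Gaussian with variance |h|^2 (s - r)
   and independent of the past; normal_prob takes the standard deviation. *)
Definition cylindrical_wiener :=
  [/\ forall s h, t <= s <= T -> measurable_fun setT (W s h),
      forall h, {ae P, forall w, W t h w = 0},
      forall s (a : R) h k, t <= s <= T ->
        {ae P, forall w, W s (a *: h + k) w = a * W s h w + W s k w},
      forall h, {ae P, forall w, {within `[t, T], continuous (fun s => W s h w)}} &
      forall r s h A B, t <= r -> r < s -> s <= T -> h != 0 ->
        filtration r A -> measurable B ->
        P (A `&` [set w | B (W s h w - W r h w)]) =
        (P A * normal_prob 0 (`|h| * Num.sqrt (s - r)) B)%E].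

End wiener.

Section stochastic_integral.
Context (R : realType) (X : hilbertType R) (H : preHilbertType R)
  (d : measure_display) (Om : measurableType d) (P : probability Om R).
Variables (W : R -> X -> Om -> R) (t s : R).


(* The elementary process 1_(event) 1_(]lo, hi]) <., in> out, where the event is
   known at time lo; elementary processes are finite sums of these. *)
Record elem_term := ElemTerm {
  et_lo : R; et_hi : R; et_event : set Om; et_in : X; et_out : H }.

Fixpoint elem_adapted (l : seq elem_term) : Prop :=
  if l is e :: l' then
    [/\ t <= et_lo e, et_lo e <= et_hi e, et_hi e <= s,
        filtration P W t (et_lo e) (et_event e) & elem_adapted l']
  else True.

Definition elem_val (l : seq elem_term) (w : Om) (r : R) (u : X) : H :=
  \sum_(e <- l)
    (\1_(et_event e) w * \1_`]et_lo e, et_hi e] r * dot u (et_in e)) *: et_out e.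

Definition elem_integral (l : seq elem_term) (w : Om) : H :=
  \sum_(e <- l)
    (\1_(et_event e) w * (W (et_hi e) (et_in e) w - W (et_lo e) (et_in e) w))
      *: et_out e.

(* The integral of Phi over [t, s] is the limit in probability of the integrals
   of elementary processes l n for which \int_t^s |Phi - l n|_HS^2 dr tends to 0
   in probability; it is unique up to a null set. *)
Definition is_stochastic_integral (Phi : Om -> R -> X -> H) (I : Om -> H) :=
  measurable_on setT (filtration P W t s) (@borel H) I /\
  exists l : nat -> seq elem_term,
    [/\ forall n, elem_adapted (l n),
        forall e : R, 0 < e ->
          P [set w | (e%:E <= \int[lebesgue_measure]_(r in `[t, s])
             hs_normsq (Phi w r \- elem_val (l n) w r)%R)%E]
          @[n --> \oo] --> 0%E &
        forall e : R, 0 < e ->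
          P [set w | e <= `|elem_integral (l n) w - I w|] @[n --> \oo] --> 0%E].

(* A version of the integral (and 0 when Phi has none). *)
Definition stochastic_integral (Phi : Om -> R -> X -> H) : Om -> H :=
  xget (fun=> 0) (is_stochastic_integral Phi).

End stochastic_integral.

Section mild.
Context (R : realType) (X : hilbertType R) (H : preHilbertType R)
  (d : measure_display) (Om : measurableType d) (P : probability Om R).

Definition mild_solution (W : R -> X -> Om -> R) (t T : R) (S : R -> H -> H)
    (b : Om -> R -> H -> H) (f : Om -> R -> H) (sigma : Om -> R -> X -> H)
    (x : H) (Y : Om -> R -> H) :=
  prog_measurable P W t T (@borel H) Y /\
  forall s, t <= s <= T -> {ae P, forall w,
    (\int[lebesgue_measure]_(r in `[t, s])
       ((`|Y w r| + `|S (s - r) (b w r (Y w r) + f w r)|)%R%:E +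
        hs_normsq (S (s - r)%R \o sigma w r)) < +oo)%E /\
    exists2 J : H,
      is_bochner_integral `[t, s] (fun r => S (s - r) (b w r (Y w r) + f w r)) J &
      Y w s = S (s - t) x + J +
        stochastic_integral P W t s (fun w' r => S (s - r) \o sigma w' r) w}.

End mild.

(* Main.v *)
Require Import Defs.
From mathcomp Require Import all_boot all_order all_algebra.
From mathcomp Require Import all_classical all_reals all_analysis.
From mathcomp Require Import generic_quotient measurable_realfun ring lra.
From mathcomp Require finmap.
Set Implicit Arguments.
Unset Strict Implicit.
Unset Printing Implicit Defensive.
Import Order.TTheory GRing.Theory Num.Theory.
Import numFieldNormedType.Exports.
Local Open Scope classical_set_scope.
Local Open Scope ring_scope.

(* The stochastic integral is the same for both solutions, so Y = X1 - X2 solves,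
   for each s and almost surely, the pathwise equation
   Y(s) = S(s-t)(x1 - x2) + \int_t^s S(s-r) g(r) dr with
   g = b(X1) - b(X2) + f1 - f2. Tested with h >= 0, |h| <= 1, it says that
   u(r) = <S(s-r) Y(r), h> is absolutely continuous with u' = <S(s-r) g(r), h>,
   and the Lipschitz bound together with positivity and contractivity of S gives
   u' >= - lam u - 2 lam |Y^-(r)|, where u(t) >= 0. Hence
   - <Y(s), h> <= 2 lam \int_t^s |Y^-(r)| dr; the supremum over h gives the same
   bound for |Y^-(s)|, and Gronwall's lemma gives Y^- = 0.
   Passing from "for each s, almost surely" to "almost surely, for almost every s"
   requires joint measurability of |Y^-|, which is a countable supremum of
   functions <-Y, h> because L^2(O) is separable. *)

(** * Scalar comparison and Gronwall lemmas *)

(** Applying $S(s-r)$ to the mild equation at time $r$ and using $S(s-r)S(r-q)=S(s-q)$ makes the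
    integrand independent of $r$, so $u$ is the primitive of one function on $[t,s]$. Orbits need
    not enter the domain of $A$, and this avoids differentiating them; likewise the duality
    $|x^-|=\sup\{-\langle x,h\rangle : h\ge 0,\ |h|\le 1\}$ avoids differentiating $|Y^-|^2$. The
    obstacle is measurability. The Bochner integrals are given separately for each $\omega$, by step
    functions that may vary with $\omega$ in any way, so $u'$ has only a representative [phi],
    measurable in time and chosen for each $\omega$. The sets to which Fubini is applied are
    therefore described by progressively measurable processes alone: [phi] is eliminated by writing
    its primitive as a limit of values of $u$ on a countable time grid. *)

Lemma ae_imp d (T : measurableType d) (R : realType)
    (mu : {measure set T -> \bar R}) (P Q : T -> Prop) :
  {ae mu, forall x, P x} -> (forall x, P x -> Q x) -> {ae mu, forall x, Q x}.
Proof. by move=> aP PQ; apply: filterS aP => x; exact: PQ. Qed.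

Lemma ae_imp2 d (T : measurableType d) (R : realType)
    (mu : {measure set T -> \bar R}) (P Q S : T -> Prop) :
  {ae mu, forall x, P x} -> {ae mu, forall x, Q x} ->
  (forall x, P x -> Q x -> S x) -> {ae mu, forall x, S x}.
Proof. by move=> aP aQ PQ; apply: filterS2 aP aQ => x; exact: PQ. Qed.

Lemma ae_Rintegral_ge0 d (T : measurableType d) (R : realType)
    (mu : {measure set T -> \bar R}) (D : set T) (f : T -> R) :
  measurable D -> mu.-integrable D (EFin \o f) ->
  {ae mu, forall x, D x -> 0 <= f x} -> 0 <= \int[mu]_(x in D) f x.
Proof.
move=> mD intf f0.
have /integrableP[mf _] := intf.
rewrite /Rintegral (ae_eq_integral (fun x => (`|f x|)%:E))//.
- by apply: fine_ge0; apply: integral_ge0 => x _; rewrite lee_fin.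
- apply/measurable_EFinP; apply: measurableT_comp => //; exact/measurable_EFinP.
- by apply: filterS f0 => x h Dx /=; rewrite ger0_norm// h.
Qed.

Lemma ae_eq_Rintegral d (T : measurableType d) (R : realType)
    (mu : {measure set T -> \bar R}) (D : set T) (f g : T -> R) :
  measurable D -> measurable_fun D f -> measurable_fun D g ->
  {ae mu, forall x, D x -> f x = g x} ->
  \int[mu]_(x in D) f x = \int[mu]_(x in D) g x.
Proof.
move=> mD mf mg fg; rewrite /Rintegral; congr fine; apply: ae_eq_integral => //.
- exact/measurable_EFinP.
- exact/measurable_EFinP.
- by apply: filterS fg => x h /h ->.
Qed.

Lemma within_continuous_dist (R : realType) (A : set R) (f : R -> R) (x e : R) :
  {within A, continuous f} -> A x -> 0 < e ->
  exists2 d, 0 < d & forall y, A y -> `|x - y| < d -> `|f x - f y| < e.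
Proof.
move=> /subspace_continuousP/(_ _ _)/cvgrPdist_lt cf Ax e0.
have := cf x Ax e e0; rewrite near_withinE => /nbhs_ballP[d /= d0 h].
by exists d => // y Ay xy; apply: h.
Qed.

Lemma last_nonneg (R : realType) (v : R -> R) (t s : R) :
  t <= s -> {within `[t, s], continuous v} -> 0 <= v t ->
  exists2 r, t <= r <= s & 0 <= v r /\ forall q, r < q <= s -> v q < 0.
Proof.
move=> ts cv vt.
pose A := [set r | t <= r <= s /\ 0 <= v r].
have At : A t by split=> //; rewrite lexx.
have ubA : has_ubound A by exists s => r [/andP[]].
have supA : has_sup A by split => //; exists t.
have tr : t <= sup A by apply: ub_le_sup.
have rs : sup A <= s by apply: ge_sup; [exists t|move=> r [/andP[]]].
exists (sup A); first by rewrite tr rs.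
split; last first.
  move=> q /andP[rq qs]; rewrite ltNge; apply/negP => vq.
  have : q <= sup A by apply: ub_le_sup => //; split=> //; rewrite qs (le_trans tr)// ltW.
  by rewrite leNgt rq.
(* Were [v] negative at [sup A], it would stay so within distance [d], where [sup_adherent] provides
   a point of [A]. *)
rewrite leNgt; apply/negP => vr.
have [d d0 h] : exists2 d, 0 < d & forall y, `[t, s]%classic y ->
    `|sup A - y| < d -> `|v (sup A) - v y| < - v (sup A).
  by apply: within_continuous_dist => //; rewrite ?oppr_gt0//= in_itv/= tr rs.
have [a [/andP[ta as_] va] la] := sup_adherent d0 supA.
have asup : a <= sup A by apply: ub_le_sup => //; split=> //; rewrite ta.
have := h a; rewrite /= in_itv/= ta as_ => /(_ isT).
rewrite ger0_norm ?subr_ge0// => /(_ _)/wrap[]; first by lra.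
rewrite ltr_norml => /andP[]; lra.
Qed.

Section scalar.
Context {R : realType}.
Local Notation mu := (@lebesgue_measure R).

Lemma Rintegral_itv_split (f : R -> R) (t r s : R) :
  mu.-integrable `[t, s] (EFin \o f) -> t <= r -> r <= s ->
  \int[mu]_(x in `[t, s]) f x =
  \int[mu]_(x in `[t, r]) f x + \int[mu]_(x in `]r, s]) f x.
Proof.
move=> intf tr rs; have /= := @Rintegral_itvB R f (BLeft t) (BRight s) r intf.
by rewrite !bnd_simp => /(_ tr rs) <-; rewrite addrC subrK.
Qed.

(* [c + \int_t^r psi] is nondecreasing in [r] wherever it is nonpositive, so it
   cannot become negative. *)
Lemma linear_comparison (psi : R -> R) (t s c lam : R) : t <= s -> 0 <= c -> 0 <= lam ->
  mu.-integrable `[t, s] (EFin \o psi) ->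
  {ae mu, forall r, `[t, s]%classic r ->
     0 <= psi r + lam * (c + \int[mu]_(x in `[t, r]) psi x)} ->
  0 <= c + \int[mu]_(x in `[t, s]) psi x.
Proof.
move=> ts c0 lam0 ipsi hpsi.
pose v r := c + \int[mu]_(x in `[t, r]) psi x.
have cv : {within `[t, s], continuous v}.
  apply/subspace_continuousP => x xts; apply: cvgD; first exact: cvg_cst.
  have := parameterized_integral_continuous ts ipsi.
  by move/subspace_continuousP => /(_ x xts).
have vt : 0 <= v t by rewrite /v set_itv1 Rintegral_set1 addr0.
have [r /andP[tr rs] [vr vneg]] := last_nonneg ts cv vt.
rewrite (Rintegral_itv_split ipsi tr rs) addrA addr_ge0//.
apply: ae_Rintegral_ge0 => //.
  by apply: integrableS ipsi => //; apply: subset_itvr; rewrite bnd_simp.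
apply: (ae_imp hpsi) => x hx; rewrite /= in_itv/= => /andP[rx xs].
have := hx; rewrite /= in_itv/= xs (le_trans tr (ltW rx)) => /(_ isT).
have : v x < 0 by apply: vneg; rewrite rx.
rewrite -/(v x) => vx; have : lam * v x <= 0 by rewrite mulr_ge0_le0// ltW.
by lra.
Qed.

(** Let $F(r)=\int_t^r N\ge 0$. Its last zero $r$ is the last time with $-F\ge 0$, which is what
    [last_nonneg] finds. If $r<T$, monotonicity of $F$ gives $F(r_1)\le K F(r_1)(r_1-r)\le F(r_1)/2$
    shortly after $r$, contradicting $F(r_1)>0$. *)
Lemma gronwall_zero (N : R -> R) (t T K : R) : t <= T -> 0 <= K ->
  mu.-integrable `[t, T] (EFin \o N) -> (forall r, 0 <= N r) ->
  {ae mu, forall r, `[t, T]%classic r -> N r <= K * \int[mu]_(x in `[t, r]) N x} ->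
  \int[mu]_(x in `[t, T]) N x = 0.
Proof.
move=> tT K0 iN N0 hN.
pose F r := \int[mu]_(x in `[t, r]) N x.
have F0 r : 0 <= F r by apply: Rintegral_ge0.
have Ft : F t = 0 by rewrite /F set_itv1 Rintegral_set1.
have iNr r : r <= T -> mu.-integrable `[t, r] (EFin \o N).
  by move=> rT; apply: integrableS iN => //; apply: subset_itvl; rewrite bnd_simp.
have Fmono q r : t <= q -> q <= r -> r <= T -> F q <= F r.
  move=> tq qr rT; rewrite /F (Rintegral_itv_split (iNr r rT) tq qr) lerDl.
  by apply: Rintegral_ge0.
have cF : {within `[t, T], continuous (fun r => - F r)}.
  apply/subspace_continuousP => x xts; apply: cvgN.
  have := parameterized_integral_continuous tT iN.
  by move/subspace_continuousP => /(_ x xts).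
have mFt : 0 <= - F t by rewrite Ft oppr0.
have [r /andP[tr rT] [Fr hr]] := last_nonneg tT cF mFt.
have {}Fr : F r = 0 by apply/eqP; rewrite eq_le F0 andbT -oppr_ge0.
move: rT; rewrite le_eqVlt => /predU1P[<- //|rT].
(* This length makes [K * (r1 - r)] at most 1/2; [K + 1] instead of [K] covers the case [K = 0]. *)
pose r1 := Num.min T (r + (2 * (K + 1))^-1).
have K1 : 0 < (2 * (K + 1))^-1 by rewrite invr_gt0; lra.
have rr1 : r < r1 by rewrite lt_min rT ltrDl K1.
have r1T : r1 <= T by rewrite ge_min lexx.
have lenr1 : r1 - r <= (2 * (K + 1))^-1 by rewrite lerBlDl ge_min lexx orbT.
have F1 : F r1 = \int[mu]_(x in `]r, r1]) N x.
  by rewrite /F (Rintegral_itv_split (iNr r1 r1T) tr (ltW rr1)) -/(F r) Fr add0r.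
have isub : mu.-integrable `]r, r1] (EFin \o N).
  by apply: integrableS (iNr r1 r1T) => //; apply: subset_itvr; rewrite bnd_simp.
have icst : mu.-integrable `]r, r1] (EFin \o cst (K * F r1)).
  apply: measurable_bounded_integrable => //=; last first.
    exists (K * F r1); split; first exact: num_real.
    by move=> M /ltW h x _ /=; apply: le_trans h; rewrite ger0_norm// mulr_ge0.
  by rewrite lebesgue_measure_itv/= lte_fin rr1 -EFinD ltry.
have le1 : F r1 <= \int[mu]_(x in `]r, r1]) (K * F r1).
  rewrite {1}F1 -subr_ge0 -RintegralB//; apply: ae_Rintegral_ge0 => //.
    exact: (integrableB _ icst isub).
  apply: (ae_imp hN) => x hx; rewrite /= in_itv/= => /andP[rx xr1].
  have xT := le_trans xr1 r1T; have tx := le_trans tr (ltW rx).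
  have := hx; rewrite /= in_itv/= tx xT => /(_ isT).
  rewrite subr_ge0 => /le_trans; apply; apply: ler_wpM2l => //.
  exact: Fmono.
have : F r1 <= (K * F r1) * (r1 - r).
  apply: (le_trans le1); rewrite Rintegral_cst//=.
  by rewrite lebesgue_measure_itv/= lte_fin rr1 -EFinD.
have K2 : K * (r1 - r) <= 2^-1.
  apply: (@le_trans _ _ (K * (2 * (K + 1))^-1)); first by apply: ler_wpM2l.
  by rewrite ler_pdivrMr; lra.
have : - F r1 < 0 by apply: hr; rewrite rr1 r1T.
rewrite oppr_lt0 => F1p.
have : F r1 * (K * (r1 - r)) <= F r1 * 2^-1 by rewrite ler_pM2l.
rewrite mulrCA mulrA; lra.
Qed.

End scalar.

(** * The space L^2 and negative parts *)

Section inner_product.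
Context (R : realType) (H : preHilbertType R).
Implicit Types x y z : H.

Lemma dotDl x y z : dot (x + y) z = dot x z + dot y z.
Proof. by have := dotDZl 1 x y z; rewrite scale1r mul1r. Qed.

Lemma dot0l z : dot 0 z = 0.
Proof. by have := dotDl 0 0 z; rewrite addr0; lra. Qed.

Lemma dotZl a x z : dot (a *: x) z = a * dot x z.
Proof. by have := dotDZl a x 0 z; rewrite addr0 dot0l addr0. Qed.

Lemma dotNl x z : dot (- x) z = - dot x z.
Proof. by rewrite -scaleN1r dotZl mulN1r. Qed.

Lemma dotBl x y z : dot (x - y) z = dot x z - dot y z.
Proof. by rewrite dotDl dotNl. Qed.

Lemma dotBr x y z : dot x (y - z) = dot x y - dot x z.
Proof. by rewrite !(dotC x) dotBl. Qed.

Lemma dot_le x y : `|dot x y| <= `|x| * `|y|.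
Proof.
have [->|x0] := eqVneq x 0; first by rewrite dot0l !normr0 mul0r.
have nx : 0 < `|x| by rewrite normr_gt0.
have h a : 0 <= a ^+ 2 * `|x| ^+ 2 + 2 * a * dot x y + `|y| ^+ 2.
  have <- : `|a *: x + y| ^+ 2 = a ^+ 2 * `|x| ^+ 2 + 2 * a * dot x y + `|y| ^+ 2.
    rewrite -!dotvv dotDl dotZl (dotC x (_ + _)) (dotC y (_ + _)) !dotDl !dotZl.
    by rewrite (dotC y x); ring.
  exact: exprn_ge0.
rewrite -(@ler_pXn2r _ 2)// ?nnegrE ?mulr_ge0// real_normK ?num_real// exprMn.
have nx2 : 0 < `|x| ^+ 2 by rewrite exprn_gt0.
(* The argument is the minimiser of the quadratic polynomial in [a]. *)
have := h (- dot x y / `|x| ^+ 2).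
have -> : (- dot x y / `|x| ^+ 2) ^+ 2 * `|x| ^+ 2 +
   2 * (- dot x y / `|x| ^+ 2) * dot x y + `|y| ^+ 2 =
   (`|x| ^+ 2 * `|y| ^+ 2 - dot x y ^+ 2) / `|x| ^+ 2.
  by field; rewrite normr_eq0.
by rewrite pmulr_lge0 ?invr_gt0// subr_ge0.
Qed.

Lemma continuous_dot (h : H) : continuous (fun x : H => dot x h).
Proof.
move=> x; apply/cvgrPdist_lt => e e0.
have d0 : 0 < e / (`|h| + 1) by rewrite divr_gt0// ltr_wpDl.
apply: filterS (nbhsx_ballx x _ d0) => y; rewrite -ball_normE /= => xy.
rewrite -dotBl (le_lt_trans (dot_le _ _))//.
rewrite (@le_lt_trans _ _ (`|x - y| * (`|h| + 1)))// ?ler_wpM2l ?lerDl//.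
by rewrite -ltr_pdivlMr ?ltr_wpDl//.
Qed.

End inner_product.

Section L2_theory.
Context d (T : measurableType d) (R : realType) (mu : {measure set T -> \bar R}).
Local Notation L2 := (L2 mu).
Implicit Types (x y h : L2).

Lemma measurable_L2 x : measurable_fun setT (x : T -> R).
Proof. by rewrite /L2_fun; exact: measurable_funPT. Qed.

Lemma L2_exists (f : T -> R) : measurable_fun setT f ->
  (\int[mu]_t (f t ^+ 2)%:E < +oo)%E -> exists x : L2, {ae mu, forall t, x t = f t}.
Proof.
move=> mf f2.
have finf : finite_norm mu 2%:E f.
  rewrite /finite_norm; rewrite unlock /Lnorm; apply: poweR_lty.
  under eq_integral.
    move=> t _; rewrite abse_EFin poweR_EFin powR_mulrn// real_normK ?num_real//.
    over.
  exact: f2.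
have fL : f \in Lfun mu 2%:E by apply/andP; split; apply/mem_set.
exists (\pi_(Defs.L2 mu)%qT (Lfun_Sub (lee1n 2) fL)).
exact: L2_pi_fun.
Qed.

Lemma normL2E x : `|x| ^+ 2 = \int[mu]_t (x t ^+ 2).
Proof. by rewrite -dotvv; apply: eq_Rintegral => t _; rewrite expr2. Qed.

Lemma integrable_sqrL2 x : mu.-integrable setT (fun t => (x t ^+ 2)%:E).
Proof.
by have := L2_integrable x x; apply: eq_integrable => // t _; rewrite /= expr2.
Qed.

Lemma normL2E_fin x : (`|x| ^+ 2)%:E = (\int[mu]_t (x t ^+ 2)%:E)%E.
Proof.
rewrite normL2E /Rintegral fineK//; apply: integrable_fin_num => //.
exact: integrable_sqrL2.
Qed.

Lemma L2_funB x y : {ae mu, forall t, (x - y : L2) t = x t - y t}.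
Proof.
rewrite -scaleN1r; apply: filterS2 (L2_funD x (-1 *: y)) (L2_funZ (-1) y) => t.
by move=> -> ->; rewrite mulN1r.
Qed.

Lemma L2_le_sub x y : L2_le x y <-> L2_le 0 (y - x).
Proof.
split; move=> h; have h0 := @L2_fun0 _ T R mu; have hB := L2_funB y x.
  by apply: filterS3 h h0 hB => t; rewrite -subr_ge0 => ? -> ->.
by apply: filterS3 h h0 hB => t /[swap] -> /[swap] ->; rewrite subr_ge0.
Qed.

Lemma dot_ge0 x h : L2_le 0 x -> L2_le 0 h -> 0 <= dot x h.
Proof.
move=> x0 h0; apply: ae_Rintegral_ge0 => //; first exact: L2_integrable.
apply: filterS3 x0 h0 (@L2_fun0 _ T R mu) => t xt ht zt _.
by rewrite mulr_ge0//; [rewrite zt in xt|rewrite zt in ht].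
Qed.

Lemma L2_neg_exists x : exists y, {ae mu, forall t, y t = Num.max (- x t) 0}.
Proof.
have mn : measurable_fun setT (fun t => Num.max (- x t) 0).
  by apply: measurable_maxr => //; apply: measurableT_comp => //; exact: measurable_L2.
apply: L2_exists => //.
have /integrableP[mx ix] := integrable_sqrL2 x.
apply: le_lt_trans ix; apply: ge0_le_integral => //.
- by move=> t _; rewrite lee_fin sqr_ge0.
- by apply/measurable_EFinP; exact: measurable_funX.
- exact: measurableT_comp.
- move=> t _; rewrite lee_fin ger0_norm ?sqr_ge0//.
  rewrite -[leRHS]sqrrN maxEle; case: ifP => // _.
  by rewrite expr0n sqr_ge0.
Qed.

Definition L2_neg x : L2 := projT1 (cid (L2_neg_exists x)).

Lemma L2_negE x : {ae mu, forall t, L2_neg x t = Num.max (- x t) 0}.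
Proof. exact: projT2 (cid (L2_neg_exists x)). Qed.

Lemma L2_neg_ge0 x : L2_le 0 (L2_neg x).
Proof.
apply: filterS2 (L2_negE x) (@L2_fun0 _ T R mu) => t -> ->.
by rewrite le_max lexx orbT.
Qed.

Lemma L2_neg_le x : L2_le (- L2_neg x) x.
Proof.
apply/L2_le_sub; rewrite opprK.
apply: filterS3 (L2_negE x) (@L2_fun0 _ T R mu) (L2_funD x (L2_neg x)) => t.
by move=> e0 -> ->; rewrite e0 addrC -lerBlDr sub0r le_max lexx.
Qed.

Lemma dot_neg x : - dot x (L2_neg x) = `|L2_neg x| ^+ 2.
Proof.
rewrite -dotvv -dotNl; apply: ae_eq_Rintegral => //.
- by apply: measurable_funM; exact: measurable_L2.
- by apply: measurable_funM; exact: measurable_L2.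
have hN : {ae mu, forall t, (- x : L2) t = - x t}.
  rewrite -scaleN1r; apply: filterS (L2_funZ (-1) x) => t ->.
  by rewrite mulN1r.
apply: filterS2 (L2_negE x) hN => t -> -> _.
by case: (leP (- x t) 0); rewrite ?mulr0.
Qed.

Lemma L2_neg_eq0 x : `|L2_neg x| = 0 -> L2_le 0 x.
Proof.
move=> /normr0_eq0 n0; have := L2_negE x; rewrite n0 => h.
apply: filterS2 h (@L2_fun0 _ T R mu) => t + e0; rewrite e0 => /esym/eqP.
by rewrite -{3}[0](_ : Num.max 0 0 = 0) ?maxxx// => /eqP m0; rewrite -oppr_le0 -m0 le_max lexx.
Qed.

(** The test vectors over which [- dot x h] has the norm of [L2_neg x] as its supremum. *)
Definition unit_cone : set L2 := [set h | L2_le 0 h /\ `|h| <= 1].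

Lemma dot_le_neg x h : unit_cone h -> - dot x h <= `|L2_neg x|.
Proof.
move=> [h0 h1].
have : 0 <= dot (x + L2_neg x) h.
  apply: dot_ge0 => //; have /L2_le_sub := L2_neg_le x.
  by rewrite opprK.
rewrite dotDl => hh.
apply: (@le_trans _ _ (dot (L2_neg x) h)); first by lra.
apply: (le_trans (ler_norm _)); apply: (le_trans (dot_le _ _)).
by rewrite -[leRHS]mulr1 ler_wpM2l.
Qed.

(** The supremum of [- dot x h] over the cone is attained at the normalised negative part, and
    continuity in [h] passes to a dense sequence. In terms of strict inequalities, superlevel sets
    become countable unions, which is the form needed for measurability. *)
Lemma norm_L2_neg_dense (D : nat -> L2) :
  (forall i, unit_cone (D i)) ->
  (forall k e, unit_cone k -> 0 < e -> exists i, `|k - D i| < e) ->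
  forall x a, a < `|L2_neg x| <-> exists i, a < - dot x (D i).
Proof.
move=> DK dD x a; split=> [ax|[i hi]]; last first.
  by apply: (lt_le_trans hi); exact: dot_le_neg.
have [k [kK kx]] : exists k, unit_cone k /\ - dot x k = `|L2_neg x|.
  have [n0|n0] := eqVneq (`|L2_neg x|) 0.
    exists 0; split; last by rewrite n0 dotC dot0l oppr0.
    by split; [apply: filterS (@L2_fun0 _ T R mu) => t ->|rewrite normr0].
  have np : 0 < `|L2_neg x| by rewrite lt0r n0 normr_ge0.
  exists (`|L2_neg x|^-1 *: L2_neg x); split; last first.
    by rewrite dotC dotZl dotC -mulrN dot_neg expr2 mulrA mulVf// mul1r.
  split.
    apply: filterS3 (L2_neg_ge0 x) (@L2_fun0 _ T R mu) (L2_funZ (`|L2_neg x|^-1) (L2_neg x)) => t.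
    by move=> h e -> ; rewrite e in h *; rewrite mulr_ge0// invr_ge0.
  by rewrite normrZ ger0_norm ?invr_ge0// mulVf.
have e0 : 0 < (`|L2_neg x| - a) / (`|x| + 1) by rewrite divr_gt0 ?subr_gt0// ltr_wpDl.
have [i hi] := dD k _ kK e0; exists i.
have : `|dot x (k - D i)| < `|L2_neg x| - a.
  apply: (le_lt_trans (dot_le _ _)).
  apply: (@le_lt_trans _ _ ((`|x| + 1) * `|k - D i|)); first by rewrite ler_wpM2r// lerDl.
  by rewrite mulrC -ltr_pdivlMr ?ltr_wpDl//.
rewrite dotBr ltr_norml => /andP[]; lra.
Qed.

End L2_theory.

(** * Separability of L^2 *)

Section rational_span.
Context (R : realType) (V : normedModType R) (Q : nat -> V).

Definition rat_comb (l : seq (nat * rat)) : V := \sum_(p <- l) ratr p.2 *: Q p.1.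

(** The closed span of [Q]. Coefficients are rational so that the combinations are indexed by a
    countable type; real multiples are recovered by approximation. *)
Definition rat_closure : set V :=
  [set z | forall e : R, 0 < e -> exists l, `|z - rat_comb l| < e].

Lemma rat_closureD x y : rat_closure x -> rat_closure y -> rat_closure (x + y).
Proof.
move=> hx hy e e0; have e2 : 0 < e / 2 by rewrite divr_gt0.
have [l hl] := hx _ e2; have [m hm] := hy _ e2; exists (l ++ m).
rewrite /rat_comb big_cat /= opprD addrACA.
by rewrite (le_lt_trans (ler_normD _ _))// [e]splitr ltrD.
Qed.

Lemma rat_closure_lim z :
  (forall e : R, 0 < e -> exists2 x, rat_closure x & `|z - x| < e) -> rat_closure z.
Proof.
move=> hz e e0; have e2 : 0 < e / 2 by rewrite divr_gt0.
have [x hx zx] := hz _ e2; have [l hl] := hx _ e2; exists l.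
by rewrite (le_lt_trans (ler_distD x _ _))// [e]splitr ltrD.
Qed.

Lemma rat_closure0 : rat_closure 0.
Proof. by move=> e e0; exists [::]; rewrite /rat_comb big_nil subrr normr0. Qed.

Lemma rat_closure_ratZ q x : rat_closure x -> rat_closure (ratr q *: x).
Proof.
move=> hx e e0; have [->|q0] := eqVneq q 0.
  by exists [::]; rewrite /rat_comb big_nil rmorph0 scale0r subrr normr0.
have nq : 0 < `|ratr q : R| by rewrite normr_gt0 fmorph_eq0.
have eq0 : 0 < e / `|ratr q : R| by rewrite divr_gt0.
have [l hl] := hx _ eq0; exists [seq (p.1, q * p.2) | p <- l].
rewrite (_ : rat_comb _ = ratr q *: rat_comb l); last first.
  rewrite /rat_comb big_map scaler_sumr; apply: eq_bigr => p _ /=.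
  by rewrite scalerA rmorphM.
by rewrite -scalerBr normrZ mulrC -ltr_pdivlMr.
Qed.

Lemma rat_closureZ a x : rat_closure x -> rat_closure (a *: x).
Proof.
move=> hx; apply: rat_closure_lim => e e0.
have d0 : 0 < e / (`|x| + 1) by rewrite divr_gt0// ltr_wpDl.
have [q] : exists q, ratr q \in `](a - e / (`|x| + 1)), a[.
  by apply: rat_in_itvoo; rewrite ltrBlDr ltrDl.
rewrite in_itv/= => /andP[q1 q2].
exists (ratr q *: x); first exact: rat_closure_ratZ.
rewrite -scalerBl normrZ ger0_norm ?subr_ge0 1?ltW//.
apply: (@le_lt_trans _ _ ((a - ratr q) * (`|x| + 1))).
  by rewrite ler_wpM2l ?lerDl// subr_ge0 ltW.
by rewrite -ltr_pdivlMr ?ltr_wpDl// ltrBlDr addrC -ltrBlDr.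
Qed.

Lemma rat_closure_sum (I : Type) (s : seq I) (F : I -> V) :
  (forall i, rat_closure (F i)) -> rat_closure (\sum_(i <- s) F i).
Proof.
move=> h; elim: s => [|i s ih]; first by rewrite big_nil; exact: rat_closure0.
by rewrite big_cons; apply: rat_closureD.
Qed.

Lemma rat_closure_gen i : rat_closure (Q i).
Proof.
move=> e e0; exists [:: (i, 1)].
by rewrite /rat_comb big_seq1 rmorph1 scale1r subrr normr0.
Qed.

Lemma rat_closure_dense : (forall z, rat_closure z) ->
  exists D : nat -> V, forall z (e : R), 0 < e -> exists i, `|z - D i| < e.
Proof.
move=> h; exists (fun n => rat_comb (odflt [::] (unpickle n))) => z e e0.
have [l hl] := h z e e0; exists (pickle l); by rewrite pickleK.
Qed.

End rational_span.

Section L2_separable.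
Import HBNNSimple.
Context d (T : measurableType d) (R : realType) (mu : {measure set T -> \bar R}).
Local Notation L2 := (L2 mu).

Lemma L2_indic_exists (A : set T) : measurable A -> (mu A < +oo)%E ->
  exists u : L2, {ae mu, forall t, u t = \1_A t}.
Proof.
move=> mA Afin; apply: L2_exists => //.
rewrite (_ : (fun t => _) = EFin \o \1_A).
  by rewrite integral_indic// setIT.
by apply/funext => t /=; rewrite indicE; case: (_ \in _); rewrite ?expr1n ?expr0n.
Qed.

(** The default 0 is taken when the indicator has no class in [L2], as may happen for a set of
    infinite measure. *)
Definition L2_indic (A : set T) : L2 :=
  xget 0 [set u : L2 | {ae mu, forall t, u t = \1_A t}].

Lemma L2_indicE (A : set T) : measurable A -> (mu A < +oo)%E ->
  {ae mu, forall t, L2_indic A t = \1_A t}.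
Proof.
by move=> mA fA; rewrite /L2_indic; case: xgetP => // h;
   have [u hu] := L2_indic_exists mA fA; have := h u.
Qed.

Lemma norm_L2_ae (x : L2) (f : T -> R) : measurable_fun setT f ->
  {ae mu, forall t, x t = f t} -> (`|x| ^+ 2)%:E = (\int[mu]_t (f t ^+ 2)%:E)%E.
Proof.
move=> mf hx; rewrite normL2E_fin; apply: ae_eq_integral => //.
- by apply/measurable_EFinP; apply: measurable_funX; exact: measurable_L2.
- by apply/measurable_EFinP; apply: measurable_funX.
- by apply: filterS hx => t ->.
Qed.

(** The square of $1_A-1_B$ is the indicator of the symmetric difference. Approximation of sets in
    measure thus becomes approximation in norm. *)
Lemma L2_indic_dist (A B : set T) : measurable A -> (mu A < +oo)%E ->
  measurable B -> (mu B < +oo)%E ->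
  (`|L2_indic A - L2_indic B| ^+ 2)%:E = mu ((A `\` B) `|` (B `\` A)).
Proof.
move=> mA fA mB fB.
have mAB : measurable ((A `\` B) `|` (B `\` A)) by apply: measurableU; apply: measurableD.
rewrite (@norm_L2_ae _ (fun t => \1_A t - \1_B t)).
- rewrite -[in RHS](setIT ((A `\` B) `|` (B `\` A))) -integral_indic//.
  apply: eq_integral => t _; congr (_%:E); rewrite !indicE !(in_setU, in_setD).
  by case: (t \in A); case: (t \in B); rewrite /= ?subrr ?subr0 ?sub0r ?sqrrN ?expr1n ?expr0n.
- by apply: measurable_funB; exact: measurable_indic.
apply: filterS3 (L2_funB (L2_indic A) (L2_indic B)) (L2_indicE mA fA) (L2_indicE mB fB).
by move=> t -> -> ->.
Qed.

Lemma L2_fun_sum (I : Type) (s : seq I) (F : I -> L2) :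
  {ae mu, forall t, (\sum_(i <- s) F i : L2) t = \sum_(i <- s) F i t}.
Proof.
elim: s => [|i s ih].
  by apply: filterS (@L2_fun0 _ T R mu) => t; rewrite !big_nil.
apply: filterS2 ih (L2_funD (F i) (\sum_(j <- s) F j)) => t e.
by rewrite !big_cons e.
Qed.

Context (C : nat -> set T).
Hypothesis mC : forall i, measurable (C i).
Hypothesis fC : forall i, (mu (C i) < +oo)%E.
Hypothesis C_dense : forall A, measurable A -> (mu A < +oo)%E ->
  forall e : R, 0 < e -> exists i, (mu ((A `\` C i) `|` (C i `\` A)) < e%:E)%E.

(** This closed subspace is shown to be everything by the usual ladder: indicators, simple
    functions, nonnegative functions, differences. *)
Let clos := rat_closure (fun i => L2_indic (C i)).

Let clos_indic A : measurable A -> (mu A < +oo)%E -> clos (L2_indic A).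
Proof.
move=> mA fA; apply: rat_closure_lim => e e0.
have e20 : 0 < e ^+ 2 by rewrite exprn_gt0.
have [i] := C_dense mA fA e20.
rewrite -L2_indic_dist// lte_fin ltr_pXn2r ?nnegrE// 1?ltW// => h.
by exists (L2_indic (C i)) => //; exact: rat_closure_gen.
Qed.

Let clos_nnsfun (g : {nnsfun T >-> R}) (x : L2) :
  {ae mu, forall t, x t = g t} -> clos x.
Proof.
move=> hx.
have ig : (\int[mu]_t (g t ^+ 2)%:E < +oo)%E by rewrite -(norm_L2_ae _ hx)// ltry.
(* Chebyshev: $y^2 1_{\{g=y\}}\le g^2$. *)
have fin y : y != 0 -> (mu (g @^-1` [set y]) < +oo)%E.
  move=> y0; have y20 : 0 < y ^+ 2 by rewrite lt0r sqrf_eq0 y0 sqr_ge0.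
  have : ((y ^+ 2)%:E * mu (g @^-1` [set y]) < +oo)%E.
    apply: le_lt_trans ig.
    rewrite -[X in mu X]setIT -integral_indic// -ge0_integralZl//; last 2 first.
    - by apply/measurable_EFinP; exact: measurable_indic.
    - by rewrite lee_fin ltW.
    apply: ge0_le_integral => //.
    - by move=> t _; rewrite -EFinM lee_fin mulr_ge0// sqr_ge0.
    - by apply/measurable_EFinP; apply: measurable_funM => //; exact: measurable_indic.
    - by apply/measurable_EFinP; apply: measurable_funX.
    move=> t _; rewrite -EFinM lee_fin indicE.
    case: (boolP (t \in _)); last by rewrite mulr0 sqr_ge0.
    by rewrite inE /= => ->; rewrite mulr1.
  rewrite !ltey; apply: contra_neq => ->.
  by rewrite gt0_muley// lte_fin.
(* The level set of 0 may have infinite measure; it contributes nothing to the sum and is left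
   out. *)
pose F y : L2 := if y == 0 then 0 else y *: L2_indic (g @^-1` [set y]).
have FE y : {ae mu, forall t, F y t = y * \1_(g @^-1` [set y]) t}.
  rewrite /F; have [->|y0] := eqVneq y 0.
    by apply: filterS (@L2_fun0 _ T R mu) => t ->; rewrite mul0r.
  have mg : measurable (g @^-1` [set y]) by [].
  apply: filterS2 (L2_funZ y (L2_indic (g @^-1` [set y]))) (L2_indicE mg (fin _ y0)) => t.
  by move=> -> ->.
pose s : seq R := finmap.enum_fset (fset_set (range g)).
have -> : x = \sum_(y <- s) F y.
  apply/L2P; have hs : {ae mu, forall t, \sum_(y <- s) F y t = g t}.
    have : {ae mu, forall t, \sum_(y <- s) F y t = \sum_(y <- s) y * \1_(g @^-1` [set y]) t}.
      elim: (s) => [|y r ih]; first by apply: aeW => t; rewrite !big_nil.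
      by apply: filterS2 ih (FE y) => t e1 e2; rewrite !big_cons e1 e2.
    apply: filterS => t ->; rewrite [RHS]fimfunE fsbig_finite//=.
  by apply: filterS3 hx hs (L2_fun_sum s F) => t -> <- ->.
apply: rat_closure_sum => y; rewrite /F; case: eqVneq => [_|y0].
  exact: rat_closure0.
by apply: rat_closureZ; apply: clos_indic; [|exact: fin].
Qed.

(** Simple functions $0\le g_n\le f$ converging to $f$ satisfy $(f-g_n)^2\le f^2$, so dominated
    convergence gives convergence in norm. *)
Let clos_ge0 (x : L2) : L2_le 0 x -> clos x.
Proof.
(* [x] is nonnegative only almost everywhere, whereas the approximation from below asks for a
   function nonnegative everywhere. *)
move=> x0; pose f t := Num.max (x t) 0.
have mf : measurable_fun setT f by apply: measurable_maxr => //; exact: measurable_L2.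
have xf : {ae mu, forall t, x t = f t}.
  by apply: filterS2 x0 (@L2_fun0 _ T R mu) => t + e; rewrite e /f => /max_idPl.
have f0 t : 0 <= f t by rewrite le_max lexx orbT.
have mEf : measurable_fun setT (EFin \o f) by apply/measurable_EFinP.
pose g := nnsfun_approx measurableT mEf.
have f0' t : setT t -> (0 <= (EFin \o f) t)%E by rewrite lee_fin.
have gf t : g n t @[n --> \oo] --> f t.
  by have /fine_cvgP[_] := cvg_nnsfun_approx measurableT mEf f0' (I : setT t).
have g_le n t : g n t <= f t.
  have := @le_approx _ _ _ _ (EFin \o f) n t f0' I.
  by rewrite /g nnsfun_approxE lee_fin.
have i2 := integrable_sqrL2 x.
have if2 : mu.-integrable setT (fun t => (f t ^+ 2)%:E).
  apply: le_integrable i2 => //.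
    by apply/measurable_EFinP; apply: measurable_funX.
  move=> t _ /=; rewrite lee_fin !ger0_norm ?sqr_ge0//.
  by rewrite /f; case: (leP (x t) 0) => // _; rewrite expr0n sqr_ge0.
have mdiff n : measurable_fun setT (fun t => f t - g n t) by apply: measurable_funB.
have [_ cv _] : [/\ mu.-integrable setT (cst 0%E),
   [sequence (\int[mu]_t `|((f t - g n t) ^+ 2)%:E - 0|)%E]_n @ \oo --> 0%E &
   [sequence (\int[mu]_t ((f t - g n t) ^+ 2)%:E)%E]_n @ \oo --> (\int[mu]_t (cst 0 t))%E].
  apply: (@dominated_convergence _ _ _ mu setT measurableT
    (fun n t => ((f t - g n t) ^+ 2)%:E) (cst 0%E) (fun t => (f t ^+ 2)%:E)) => //.
  - by move=> n; apply/measurable_EFinP; apply: measurable_funX.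
  - apply: aeW => t _; apply: cvg_EFin; first by apply: nearW.
    have -> : 0 = (f t - f t) ^+ 2 :> R by rewrite subrr expr0n.
    have h : f t - g n t @[n --> \oo] --> f t - f t by apply: cvgB (gf t); exact: cvg_cst.
    by under eq_fun do rewrite /= expr2; rewrite expr2; apply: cvgM.
  - apply: aeW => t n _; rewrite abse_EFin lee_fin ger0_norm ?sqr_ge0//.
    rewrite ler_pXn2r ?nnegrE ?subr_ge0//.
    by rewrite lerBlDr lerDl; exact: fun_ge0.
apply: rat_closure_lim => e e0.
have e20 : 0 < e ^+ 2 by rewrite exprn_gt0.
have [n hn] : exists n, (\int[mu]_t ((f t - g n t) ^+ 2)%:E < (e ^+ 2)%:E)%E.
  have /fine_cvgP[ffin /cvgrPdist_lt/(_ _ e20) fdist] := cv.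
  near \oo => n; exists n.
  rewrite (_ : (\int[mu]_t _)%E = (\int[mu]_t `|((f t - g n t) ^+ 2)%:E - 0|)%E); last first.
    by apply: eq_integral => t _; rewrite sube0 gee0_abs// lee_fin sqr_ge0.
  have fn : (\int[mu]_t `|((f t - g n t) ^+ 2)%:E - 0|)%E \is a fin_num by near: n.
  rewrite -(fineK fn) lte_fin; apply: (le_lt_trans (ler_norm _)).
  by rewrite -normrN -sub0r; near: n.
have [u hu] : exists u : L2, {ae mu, forall t, u t = g n t}.
  apply: L2_exists => //.
  have /integrableP[mx ix] := if2.
  apply: le_lt_trans ix; apply: ge0_le_integral => //.
  - by move=> t _; rewrite lee_fin sqr_ge0.
  - by apply/measurable_EFinP; exact: measurable_funX.
  - exact: measurableT_comp.
  - move=> t _; rewrite abse_EFin lee_fin ger0_norm ?sqr_ge0//.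
    by rewrite ler_pXn2r ?nnegrE//; exact: fun_ge0.
exists u; first exact: clos_nnsfun hu.
rewrite -(@ltr_pXn2r _ 2)// ?nnegrE// 1?ltW// -lte_fin.
rewrite (@norm_L2_ae _ (fun t => f t - g n t))//.
by apply: filterS3 (L2_funB x u) xf hu => t -> -> ->.
Unshelve. all: by end_near. Qed.

Lemma L2_separable :
  exists D : nat -> L2, forall z (e : R), 0 < e -> exists i, `|z - D i| < e.
Proof.
suff h (z : L2) : clos z by exact: rat_closure_dense h.
(* [L2_neg (- z)] is the positive part of [z]. *)
have -> : z = L2_neg (- z) + (-1) *: L2_neg z.
  apply/L2P; have h1 := L2_negE (- z); have h2 := L2_negE z.
  have h3 := L2_funD (L2_neg (- z)) ((-1) *: L2_neg z).
  have h4 := L2_funZ (-1) (L2_neg z).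
  have h5 : {ae mu, forall t, (- z : L2) t = - z t}.
    by rewrite -scaleN1r; apply: filterS (L2_funZ (-1) z) => t ->; rewrite mulN1r.
  near=> t; rewrite (near h3 t)// (near h4 t)// (near h1 t)// (near h2 t)// (near h5 t)//.
  rewrite opprK mulN1r; case: (leP (z t) 0) => z0.
    by rewrite max_l ?oppr_ge0// opprK add0r.
  by rewrite max_r ?oppr0 ?addr0// oppr_le0 ltW.
apply: rat_closureD; first by apply: clos_ge0; exact: L2_neg_ge0.
by apply: rat_closureZ; apply: clos_ge0; exact: L2_neg_ge0.
Unshelve. all: by end_near. Qed.

End L2_separable.

(** * Lebesgue measure on [O]: approximation by finite unions of rational boxes *)

Section L2_on_separable.
Context (R : realType) (n : nat).
Local Notation E := 'rV[R]_n.+1.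
Local Notation Q := 'rV[rat]_n.+1.

Definition rat_box (p : Q * Q) : set E :=
  box (map_mx ratr p.1) (map_mx ratr p.2).

Definition rat_boxes (l : seq (Q * Q)) : set E :=
  [set x | exists2 p, p \in l & rat_box p x].

Definition rat_volume (p : Q * Q) : \bar R :=
  box_volume (map_mx ratr p.1 : E) (map_mx ratr p.2 : E).

(** The volume of the box enlarged by [dl] at both ends of each side is a polynomial in [dl], hence
    continuous at 0. Rational corners are then picked inside the collar. *)
Lemma rat_box_cover (a b : E) (e : R) : 0 < e ->
  (forall i, a ord0 i <= b ord0 i) ->
  exists p : Q * Q, [/\ (forall i, ratr (p.1 ord0 i) <= ratr (p.2 ord0 i) :> R),
    box a b `<=` rat_box p & (rat_volume p <= box_volume a b + e%:E)%E].
Proof.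
move=> e0 ab.
pose P : {poly R} := \prod_(i < n.+1) ((b ord0 i - a ord0 i)%:P + 2%:P * 'X).
have PE x : P.[x] = \prod_i (b ord0 i - a ord0 i + 2 * x).
  by rewrite horner_prod; apply: eq_bigr => i _; rewrite !hornerE.
have [dl dl0 Pdl] : exists2 dl, 0 < dl & P.[dl] < P.[0] + e.
  have /cvgrPdist_lt/(_ _ e0)/nbhs_ballP[r /= r0 h] := @continuous_horner R P 0.
  exists (r / 2); first by rewrite divr_gt0.
  have : ball (0 : R) r (r / 2).
    rewrite -ball_normE /= sub0r normrN ger0_norm ?divr_ge0// 1?ltW//.
    by rewrite ltr_pdivrMr// ltr_pMr// ltr1n.
  by move=> /h /=; rewrite ltr_norml => /andP[]; lra.
have hp i : exists q : rat, ratr q \in `](a ord0 i - dl), (a ord0 i)[.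
  by apply: rat_in_itvoo; rewrite ltrBlDr ltrDl.
have hq i : exists q : rat, ratr q \in `](b ord0 i), (b ord0 i + dl)[.
  by apply: rat_in_itvoo; rewrite ltrDl.
have [p pE] := choice hp; have [q qE] := choice hq.
have {}pE i : a ord0 i - dl < ratr (p i) < a ord0 i by have := pE i; rewrite in_itv.
have {}qE i : b ord0 i < ratr (q i) < b ord0 i + dl by have := qE i; rewrite in_itv.
have pq i : ratr (p i) <= ratr (q i) :> R.
  by have := pE i; have := qE i; have := ab i; move=> h /andP[h1 h2] /andP[h3 h4]; lra.
exists (\row_i p i, \row_i q i); split => /=.
- by move=> i; rewrite !mxE.
- move=> x xab i; rewrite !mxE.
  have := xab i; have := pE i; have := qE i => /andP[h1 h2] /andP[h3 h4] /andP[h5 h6].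
  by apply/andP; split; lra.
rewrite /rat_volume /box_volume -EFinD lee_fin /=.
apply: (@le_trans _ _ P.[dl]); last first.
  apply: (le_trans (ltW Pdl)); rewrite lerD2r PE.
  by apply: ler_prod => i _; rewrite mulr0 addr0 subr_ge0 ab lexx.
rewrite PE; apply: ler_prod => i _; rewrite !mxE subr_ge0 pq /=.
by have := pE i; have := qE i => /andP[h1 h2] /andP[h3 h4]; lra.
Qed.

Context (O : set E).
Local Notation m := (lebesgue_outer_on O).

Lemma lebesgue_on_le (A : set E) : (m A <= lebesgue_outer A)%E.
Proof. exact: le_lebesgue_outer. Qed.

Lemma lebesgue_outer_rat_boxes (p : nat -> Q * Q) :
  (forall k i, ratr ((p k).1 ord0 i) <= ratr ((p k).2 ord0 i) :> R) ->
  (lebesgue_outer (\bigcup_k rat_box (p k)) <= \sum_(k <oo) rat_volume (p k))%E.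
Proof.
move=> hp; apply: ereal_inf_lbound.
exists ((fun k => map_mx ratr (p k).1), (fun k => map_mx ratr (p k).2)) => //.
by split => //= k i; rewrite !mxE.
Qed.

(* Finitely many boxes of an almost optimal cover of [A] are used: the part of [A]
   they miss lies in the tail of the cover, and by Caratheodory measurability of
   [A] the union of the cover exceeds [A] by little. *)
Lemma rat_boxes_dense (A : set E) (e : R) : m.-cara.-measurable A ->
  (m A < +oo)%E -> 0 < e ->
  exists l, (m (A `\` rat_boxes l) + m (rat_boxes l `\` A) < e%:E)%E.
Proof.
(* One quarter pays for the almost optimal cover, one for making its boxes rational, one for the
   discarded tail; the last is slack. *)
move=> mA fA e0; pose dl := e / 4.
have dl0 : 0 < dl by rewrite divr_gt0.
have fin : lebesgue_outer (A `&` O) \is a fin_num.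
  by rewrite ge0_fin_numE// lebesgue_outer_ge0.
have [_ [c [cab cA] <-] hc] := lb_ereal_inf_adherent dl0 fin.
have hp k : exists p : Q * Q, [/\ (forall i, ratr (p.1 ord0 i) <= ratr (p.2 ord0 i) :> R),
    box (c.1 k) (c.2 k) `<=` rat_box p &
    (rat_volume p <= box_volume (c.1 k) (c.2 k) + (dl / (2 ^ k.+1)%:R)%:E)%E].
  by apply: rat_box_cover => //; rewrite divr_gt0// ltr0n expn_gt0.
have [p pP] := choice hp.
have ple k i : ratr ((p k).1 ord0 i) <= ratr ((p k).2 ord0 i) :> R by have [] := pP k.
have vol0 k : (0 <= rat_volume (p k))%E.
  by apply: box_volume_ge0 => i; rewrite !mxE.
pose U := \bigcup_k rat_box (p k).
have AU : A `&` O `<=` U by move=> x /cA[k _ xk]; exists k => //; have [_ + _] := pP k; exact.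
have sum_lt : (\sum_(k <oo) rat_volume (p k) < m A + (dl + dl)%:E)%E.
  rewrite EFinD addeA; apply: (@le_lt_trans _ _ (cover_volume c + dl%:E)%E); last first.
    by rewrite lteD2rE.
  apply: le_trans (epsilon_trick _ _ (ltW dl0)); last first.
    by move=> k; apply: box_volume_ge0; exact: cab.
  by apply: lee_nneseries => // k _; have [] := pP k.
have mU : (m U < m A + (dl + dl)%:E)%E.
  apply: le_lt_trans sum_lt; apply: (le_trans (lebesgue_on_le _)).
  exact: lebesgue_outer_rat_boxes.
have mUA : (m (U `\` A) < (dl + dl)%:E)%E.
  have mAU : (m A <= m (U `&` A))%E.
    by apply: le_lebesgue_outer => x [Ax Ox]; split => //; split => //; exact: AU.
  have fA' : m A \is a fin_num by [].
  have := mA U; rewrite -setDE => eU; move: mU; rewrite eU => mU.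
  rewrite -(@lteD2lE _ (m A))//; apply: le_lt_trans mU.
  exact: leeD2r.
have [N hN] : exists N, (\sum_(N <= k <oo) rat_volume (p k) < dl%:E)%E.
  have sfin : (\sum_(k <oo) rat_volume (p k) < +oo)%E.
    by apply: (lt_le_trans sum_lt); rewrite leey.
  have := nneseries_tail_cvg sfin (fun k _ => vol0 k).
  move=> /fine_cvgP[ffin /cvgrPdist_lt/(_ _ dl0) fdist].
  near \oo => N; exists N.
  have fn : (\sum_(N <= k <oo) rat_volume (p k))%E \is a fin_num by near: N.
  rewrite -(fineK fn) lte_fin; apply: (le_lt_trans (ler_norm _)).
  by rewrite -normrN -sub0r; near: N.
exists [seq p k | k <- iota 0 N].
have -> : e%:E = (dl%:E + ((dl + dl) + dl)%:E)%E.
  by rewrite -EFinD; congr (_%:E); rewrite /dl; field.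
have lt1 : (m (A `\` rat_boxes [seq p k | k <- iota 0 N]) < dl%:E)%E.
  apply: le_lt_trans hN; rewrite -nneseries_addn//.
  apply: (le_trans _ (@lebesgue_outer_rat_boxes (fun k => p (k + N)%N) _)) => //.
  apply: le_lebesgue_outer => x [[Ax nx] Ox].
  have [k _ xk] : U x by exact: AU.
  have [kN|Nk] := ltnP k N.
    exfalso; apply: nx; exists (p k) => //.
    by apply/mapP; exists k => //; rewrite mem_iota.
  by exists (k - N)%N => //; rewrite subnK.
apply: lteD => //; apply: (@le_lt_trans _ _ (m (U `\` A))); last first.
  by apply: (lt_trans mUA); rewrite lte_fin ltrDl.
apply: le_lebesgue_outer => x [[[q ql xq] nA] Ox]; split => //; split => //.
by move: ql => /mapP[k _ qE]; exists k => //; rewrite -qE.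
Unshelve. all: by end_near. Qed.

(** Measurability of the boxes for the trace measure is bypassed. For each finite list of rational
    boxes and each [n], [C0] selects a measurable set of finite measure within $1/(n+1)$ of their
    union, if there is one. A set [A] close to a union witnesses that the selection succeeds, and
    the triangle inequality for symmetric differences compares [A] with the selected set. *)
Lemma L2_on_separable :
  exists D : nat -> L2_on O, forall z (e : R), 0 < e -> exists i, `|z - D i| < e.
Proof.
pose good (ln : seq (Q * Q) * nat) (X : set E) := [/\ m.-cara.-measurable X, (m X < +oo)%E &
   (m (X `\` rat_boxes ln.1) + m (rat_boxes ln.1 `\` X) < (ln.2.+1%:R^-1)%:E)%E].
pose C0 ln := if pselect (exists X, good ln X) is left h then projT1 (cid h) else set0.
have C0P ln : (exists X, good ln X) -> good ln (C0 ln).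
  by rewrite /C0; case: pselect => // h _; exact: (projT2 (cid h)).
pose C i := odflt set0 (omap C0 (unpickle i)).
have mfC i : m.-cara.-measurable (C i) /\ (m (C i) < +oo)%E.
  have m0 : m.-cara.-measurable (set0 : set (caratheodory_type m)) /\ (m set0 < +oo)%E.
    by split; [exact: measurable0|rewrite outer_measure0].
  rewrite /C; case: unpickle => //= ln.
  have [h|h] := pselect (exists X, good ln X); first by have [] := C0P ln h.
  by rewrite /C0; case: pselect.
apply: (@L2_separable _ _ _ (lebesgue_measure_on O) C).
- by move=> i; have [] := mfC i.
- by move=> i; have [] := mfC i.
move=> A mA fA e e0.
pose k := Num.truncn (2 / e).
have k0 : 0 < k.+1%:R^-1 :> R by rewrite invr_gt0 ltr0n.
have [l hl] := rat_boxes_dense mA fA k0.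
have gX : exists X, good (l, k) X by exists A.
have [mX fX hX] := C0P _ gX.
exists (pickle (l, k)); rewrite /C pickleK /=; set X := C0 (l, k) in mX fX hX *.
have mU (B1 B2 : set E) : (m (B1 `|` B2) <= m B1 + m B2)%E.
  by have := @outer_measureU2 _ _ m B1 B2.
have kk : (k.+1%:R^-1 + k.+1%:R^-1 < e)%R.
  have -> (x : R) : x + x = 2 * x by ring.
  rewrite ltr_pdivrMr ?ltr0n// mulrC -ltr_pdivrMr//.
  exact: truncnS_gt.
apply: (@le_lt_trans _ _ (m (A `\` X) + m (X `\` A))%E); first exact: mU.
apply: (@le_lt_trans _ _ ((m (A `\` rat_boxes l) + m (rat_boxes l `\` A)) +
   (m (X `\` rat_boxes l) + m (rat_boxes l `\` X)))%E); last first.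
  apply: (@lt_trans _ _ (k.+1%:R^-1 + k.+1%:R^-1)%:E); last by rewrite lte_fin.
  by rewrite EFinD; apply: lteD.
apply: (@le_trans _ _ ((m (A `\` rat_boxes l) + m (rat_boxes l `\` X)) +
   (m (X `\` rat_boxes l) + m (rat_boxes l `\` A)))%E).
  apply: leeD; apply: le_trans (mU _ _); apply: le_outer_measure => x [h1 h2];
    by have [h|h] := pselect (rat_boxes l x); [right|left].
by rewrite addeACA [in leRHS]addeACA (addeC (m (rat_boxes l `\` X))).
Qed.

End L2_on_separable.

(** * Bochner integrals tested with functionals *)

(* [f2] need not be measurable: the integral of a nonnegative function is a
   supremum over the simple functions below it. *)
Lemma le_integral_nonmeasurable d (T : measurableType d) (R : realType)
    (mu : {measure set T -> \bar R}) (D : set T) (f1 f2 : T -> \bar R) :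
  measurable D -> measurable_fun D f1 ->
  (forall x, D x -> 0 <= f1 x)%E -> (forall x, D x -> 0 <= f2 x)%E ->
  {ae mu, forall x, D x -> (f1 x <= f2 x)%E} ->
  (\int[mu]_(x in D) f1 x <= \int[mu]_(x in D) f2 x)%E.
Proof.
move=> mD mf1 f10 f20 [N [mN N0 hN]].
rewrite (ge0_negligible_integral mN)// !ge0_integralE//; last first.
  by move=> x [Dx _]; exact: f10.
apply: le_ereal_sup => _ [g gf <-]; exists g => // x.
apply: (le_trans (gf x)); rewrite /patch.
case: ifPn => [|_]; last first.
  by case: ifPn => // /set_mem; exact: f20.
move=> /set_mem[Dx Nx]; rewrite mem_set//.
by apply: contrapT => h; apply: Nx; apply: hN => /= /(_ Dx).
Qed.

Section bochner_functional.
Context (R : realType) (H : normedModType R).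
Local Notation mu := (@lebesgue_measure R).

(** The function [l (g r)] is known only as an almost everywhere limit, so [phi] is the upper limit
    of the scalar step functions [psi n], which is measurable without exception. The bound on [l]
    turns the convergence of the steps to [g] into convergence of [psi n] to [phi] in $L^1$, which
    identifies the integral. *)
Lemma bochner_functional (D : set R) (g : R -> H) (J : H) (l : H -> R) (C : R) :
  measurable (D : set (measurableTypeR R)) ->
  (forall a x y, l (a *: x + y) = a * l x + l y) ->
  0 < C -> (forall x, `|l x| <= C * `|x|) ->
  is_bochner_integral D g J ->
  exists phi : R -> R, [/\ mu.-integrable D (EFin \o phi),
    {ae mu, forall r, D r -> phi r = l (g r)} & \int[mu]_(r in D) phi r = l J].
Proof.
move=> mD lin_l C0 lC [L [hL Lg iL LJ]].
have lD x y : l (x + y) = l x + l y by have := lin_l 1 x y; rewrite scale1r mul1r.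
have l0 : l 0 = 0 by have := lD 0 0; rewrite addr0; lra.
have lZ a x : l (a *: x) = a * l x by have := lin_l a x 0; rewrite !addr0 l0 addr0.
have lB x y : l (x - y) = l x - l y by rewrite lD -scaleN1r lZ mulN1r.
have lsum (I : Type) (s : seq I) (F : I -> H) : l (\sum_(i <- s) F i) = \sum_(i <- s) l (F i).
  by elim: s => [|i s ih]; rewrite ?big_nil ?l0// !big_cons lD ih.
have cl (u : nat -> H) (y : H) : u n @[n --> \oo] --> y -> l (u n) @[n --> \oo] --> l y.
  move=> /cvgrPdist_lt uy; apply/cvgrPdist_lt => e e0.
  have eC : 0 < e / C by rewrite divr_gt0.
  apply: filterS (uy _ eC) => n h.
  by rewrite -lB (le_lt_trans (lC _))// mulrC -ltr_pdivlMr.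
pose psi n r := l (step_fun (L n) r).
have psiE n r : psi n r = \sum_(p <- L n) \1_(p.1) r * l p.2.
  by rewrite /psi /step_fun lsum; apply: eq_bigr => p _; rewrite lZ.
have step_int (s : seq (set (measurableTypeR R) * H)) :
    (forall p, p \in s -> [/\ measurable p.1, p.1 `<=` D & (lebesgue_measure p.1 < +oo)%E]) ->
    mu.-integrable D (EFin \o (fun r => \sum_(p <- s) \1_(p.1) r * l p.2)) /\
    \int[mu]_(r in D) (\sum_(p <- s) \1_(p.1) r * l p.2) =
    \sum_(p <- s) fine (lebesgue_measure p.1) * l p.2.
  elim: s => [_|p s ih hs].
    have -> : (fun r => \sum_(p <- [::]) \1_(p.1) r * l p.2) = cst 0 :> (R -> R).
      by apply/funext => r; rewrite big_nil.
    by rewrite big_nil /Rintegral integral0; split => //; exact: integrable0.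
  have [q|is_ sumE] := ih; first by move=> qs; apply: hs; rewrite inE qs orbT.
  have [mp pD fp] := hs p (mem_head _ _).
  have i1 : mu.-integrable D (EFin \o (\1_(p.1) : R -> R)).
    apply/integrableP; split; first by apply/measurable_EFinP; exact: measurable_indic.
    under eq_integral => r _ do rewrite /= ger0_norm//.
    by rewrite integral_indic// setIidl.
  have ip : mu.-integrable D (EFin \o (fun r => \1_(p.1) r * l p.2)).
    have := @integrableZr _ _ _ mu D mD (l p.2) _ i1.
    by apply: eq_integrable => // r _ /=.
  have -> : (fun r => \sum_(q <- p :: s) \1_(q.1) r * l q.2) =
     (fun r => \1_(p.1) r * l p.2 + \sum_(q <- s) \1_(q.1) r * l q.2) :> (R -> R).
    by apply/funext => r; rewrite big_cons.
  split.
    by have := integrableD mD ip is_; apply: eq_integrable => // r _ /=; rewrite EFinD.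
  rewrite big_cons RintegralD// sumE RintegralZr//; congr (_ * _ + _).
  by rewrite /Rintegral integral_indic// setIidl.
have ipsi n : mu.-integrable D (EFin \o psi n).
  by have -> : psi n = _ := funext (psiE n); have [] := step_int _ (hL n).
have psi_int n : \int[mu]_(r in D) psi n r = l (step_integral (L n)).
  have -> : psi n = _ := funext (psiE n); have [_ ->] := step_int _ (hL n).
  by rewrite /step_integral lsum; apply: eq_bigr => p _; rewrite lZ.
pose phi r := fine (limn_esup (fun n => (psi n r)%:E)).
have mphi : measurable_fun D phi.
  apply: measurableT_comp => //; apply: measurable_fun_limn_esup => n.
  by have /integrableP[] := ipsi n.
have phiE : {ae mu, forall r, D r -> phi r = l (g r)}.
  apply: (ae_imp Lg) => r h Dr.
  have cv : (psi n r)%:E @[n --> \oo] --> (l (g r))%:E.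
    by apply: cvg_EFin; [exact: nearW|apply: cl; exact: h].
  by rewrite /phi is_cvg_limn_esupE ?(cvg_lim _ cv)//; apply/cvg_ex; eexists; exact: cv.
(* The constant stands with the measurable integrand: the norm of [g r - step_fun (L n) r] need not
   be measurable in [r], so no factor is moved through its integral. *)
have mdist n : measurable_fun D (fun r => C^-1 * `|phi r - psi n r|).
  apply: measurable_funM => //; apply: measurableT_comp => //; apply: measurable_funB => //.
  by have /integrableP[/measurable_EFinP] := ipsi n.
have dist_le n : (\int[mu]_(r in D) (C^-1 * `|phi r - psi n r|)%:E <=
   \int[mu]_(r in D) `|g r - step_fun (L n) r|%:E)%E.
  apply: le_integral_nonmeasurable => //.
  - by apply/measurable_EFinP; exact: mdist.
  - by move=> r _; rewrite lee_fin mulr_ge0// invr_ge0 ltW.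
  apply: (ae_imp phiE) => r h Dr; rewrite lee_fin h// -lB.
  by rewrite ler_pdivrMl.
have dist_cvg : (\int[mu]_(r in D) `|(phi r - psi n r)%:E|)%E @[n --> \oo] --> 0%E.
  have cvC : (C%:E * \int[mu]_(r in D) `|g r - step_fun (L n) r|%:E)%E @[n --> \oo] --> (C%:E * 0)%E.
    by apply: cvgeZl.
  rewrite mule0 in cvC.
  apply: (squeeze_cvge _ (cvg_cst 0%E) cvC).
  apply: nearW => n; rewrite integral_ge0//=.
  apply: (@le_trans _ _ (C%:E * \int[mu]_(r in D) (C^-1 * `|phi r - psi n r|)%:E)%E); last first.
    by rewrite lee_pmul2l// lte_fin.
  rewrite -ge0_integralZl//; last 3 first.
  - by apply/measurable_EFinP; exact: mdist.
  - by move=> r _; rewrite lee_fin mulr_ge0// invr_ge0 ltW.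
  - by rewrite lee_fin ltW.
  rewrite le_eqVlt; apply/orP; left; apply/eqP; apply: eq_integral => r _.
  by rewrite -EFinM mulrA mulfV ?mul1r// gt_eqF.
(* One finite distance is enough: adding [psi n] back makes [phi] integrable. *)
have idist : exists n, mu.-integrable D (fun r => (phi r - psi n r)%:E).
  have /fine_cvgP[[n _ /(_ n (leqnn n)) fn] _] := dist_cvg.
  exists n; apply/integrableP; split; last by rewrite ltey_eq fn.
  apply/measurable_EFinP; apply: measurable_funB => //.
  by have /integrableP[/measurable_EFinP] := ipsi n.
have iphi : mu.-integrable D (EFin \o phi).
  have [n hn] := idist.
  have := integrableD mD hn (ipsi n); apply: eq_integrable => // r _ /=.
  by rewrite -EFinD subrK.
exists phi; split => //.
have cv1 : \int[mu]_(r in D) psi n r @[n --> \oo] --> l J.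
  by under eq_fun do rewrite psi_int; exact: cl.
have cv2 : \int[mu]_(r in D) psi n r @[n --> \oo] --> \int[mu]_(r in D) phi r.
  apply/cvgrPdist_le => e e0.
  have /fine_cvgP[fin /cvgrPdist_le/(_ _ e0) h] := dist_cvg.
  near=> n; rewrite -(RintegralB mD iphi (ipsi n)).
  apply: (le_trans (le_normr_Rintegral _ _)) => //.
    exact: (integrableB _ iphi (ipsi n)).
  have : `|0 - (fine \o (fun n => \int[mu]_(r in D) `|(phi r - psi n r)%:E|)%E) n| <= e by near: n.
  by rewrite sub0r normrN => /(le_trans (ler_norm _)).
exact: cvg_unique cv2 cv1.
Unshelve. all: by end_near. Qed.

End bochner_functional.

(** * Joint measurability and Fubini *)

Section joint_measurability.
Context (R : realType) (X : hilbertType R) (d : measure_display)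
  (Om : measurableType d) (P : probability Om R).
Variables (W : R -> X -> Om -> R) (t T : R).
Hypothesis P_complete : measure_is_complete P.
Hypothesis W_wiener : cylindrical_wiener P W t T.

Lemma filtration_measurable s : t <= s <= T -> filtration P W t s `<=` measurable.
Proof.
move=> /andP[ts sT]; apply: smallest_sub; first exact: sigma_algebra_measurable.
move=> A [[r [h [B [/andP[tr rs] mB ->]]]]|]; last exact: P_complete.
have [mW _ _ _ _] := W_wiener.
have := mW r h; rewrite tr (le_trans rs sT) => /(_ isT).
by rewrite -[X in measurable X]setTI; apply.
Qed.

(** Progressive measurability at the final time [T] is joint measurability, since by completeness of
    [P] the filtration consists of measurable sets. *)
Lemma prog_measurable_set (A : set (Om * measurableTypeR R)) : t <= T ->
  prog P W t T A -> measurable A.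
Proof.
move=> tT [AT /(_ T)]; rewrite tT lexx (setIidl AT) => /(_ isT).
have mtT : measurable (`[t, T]%classic : set (measurableTypeR R)) by [].
have mD : measurable ([set: Om] `*` (`[t, T]%classic : set (measurableTypeR R))).
  exact: measurableX.
suff : product_sigma setT `[t, T] (filtration P W t T)
    [set B : set R | measurable (B : set (measurableTypeR R)) /\ B `<=` `[t, T]] `<=`
    [set B | measurable (B : set (Om * measurableTypeR R))] by apply.
apply: smallest_sub.
  split => [||F mF]; first exact: measurable0.
    by move=> B mB; exact: measurableD.
  by apply: bigcup_measurable => k _; exact: mF.
move=> _ [B mB [C [mC _] <-]]; apply: measurableX => //.
by apply: (@filtration_measurable T) => //; rewrite tT lexx.
Qed.

Lemma prog_measurable_fun (V : topologicalType) (Y : Om -> R -> V) (l : V -> R) :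
  t <= T -> prog_measurable P W t T (@borel V) Y -> continuous l ->
  measurable_fun ([set: Om] `*` (`[t, T]%classic : set (measurableTypeR R)))
    (fun p => l (Y p.1 p.2)).
Proof.
move=> tT mY cl.
apply: (measurability _ (RGenOInfty.measurableE R)).
move=> _ [_ [x ->] <-]; apply: prog_measurable_set => //.
rewrite (_ : (fun p => _) @^-1` _ = (fun p => Y p.1 p.2) @^-1` (l @^-1` `]x, +oo[)).
  apply: mY; apply: sub_gen_smallest; apply: open_comp => //.
by [].
Qed.

End joint_measurability.

Section fubini_ae.
Context (R : realType) (d : measure_display) (Om : measurableType d) (P : probability Om R).
Local Notation mu := (@lebesgue_measure R).

(** By Tonelli, a measurable exceptional set whose sections at fixed time are null has null sections
    for almost every [w]. Each application has to supply the measurability of that set. *)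
Lemma fubini_ae (D : set R) (Q : Om -> R -> Prop) :
  measurable ([set p | D p.2 /\ ~ Q p.1 p.2] : set (Om * measurableTypeR R)) ->
  (forall r, D r -> {ae P, forall w, Q w r}) ->
  {ae P, forall w, {ae mu, forall r, D r -> Q w r}}.
Proof.
move=> mE hQ; set E := [set p | _] in mE.
have y0 r : P (ysection E r) = 0%E.
  have [Dr|nDr] := pselect (D r); last first.
    by rewrite (_ : ysection E r = set0) ?measure0// -subset0 => w; rewrite /ysection/= inE => -[].
  apply: (measure_negligible (measurable_ysection r mE)).
  by apply: negligibleS (hQ r Dr) => w; rewrite /ysection/= inE => -[].
have F0 : (\int[P]_w (mu \o xsection E) w = 0)%E.
  rewrite -(indic_fubini_tonelli_FE mu mE) (indic_fubini_tonelli P mu mE).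
  rewrite (indic_fubini_tonelli_GE P mE); apply: integral0_eq => r _.
  exact: y0.
have mF : measurable_fun setT (mu \o xsection E) by exact: measurable_fun_xsection.
have : ae_eq P setT (mu \o xsection E) (cst 0%E).
  apply/(ae_eq_integral_abs P measurableT mF); rewrite -[RHS]F0.
  by apply: eq_integral => w _; rewrite gee0_abs.
apply: filterS => w /(_ I) /= h.
exists (xsection E w); split => //; first exact: measurable_xsection.
by move=> r /= /not_implyP[Dr nQ]; rewrite /xsection /= inE.
Qed.

End fubini_ae.

(** * Approximation of times from below on a countable grid *)

Section grid.
Context (R : realType) (t : R).

(** [r] rounded down to mesh $1/(n+1)$ counted from [t]. Rounding down keeps [s - grid n r] at least
    [s - r], so right continuity of the semigroup at 0 suffices for convergence. *)
Definition grid (n : nat) (r : R) : R :=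
  t + (Num.truncn ((r - t) * n.+1%:R))%:R / n.+1%:R.

Lemma grid_ge n r : t <= grid n r.
Proof. by rewrite lerDl divr_ge0. Qed.

Lemma grid_le n r : t <= r -> grid n r <= r.
Proof.
move=> tr; rewrite /grid -lerBrDl ler_pdivrMr ?ltr0n//.
by rewrite truncn_le// mulr_ge0// subr_ge0.
Qed.

Lemma grid_cvg r : t <= r -> grid n r @[n --> \oo] --> r.
Proof.
move=> tr; apply/cvgrPdist_lt => e e0.
near=> n; rewrite ger0_norm ?subr_ge0 ?grid_le//.
have n0 : 0 < n.+1%:R :> R by rewrite ltr0n.
apply: (@lt_trans _ _ n.+1%:R^-1).
  have hE (k : R) : n.+1%:R^-1 + k / n.+1%:R = (k + 1) / n.+1%:R.
    by rewrite mulrDl mul1r addrC.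
  rewrite /grid opprD addrA ltrBlDr hE ltr_pdivlMr// natr1.
  exact: truncnS_gt.
by near: n; exact: near_infty_natSinv_lt (PosNum e0).
Unshelve. all: by end_near. Qed.

Context (d : measure_display) (Om : measurableType d) (s : R).
Let D : set (Om * measurableTypeR R) := setT `*` `[t, s]%classic.

(** On each of the countably many strips where the grid time is constant, the function is one of the
    measurable [G (u k)]; strips with [u k] beyond [s] are empty. *)
Lemma measurable_grid_comp (G : R -> Om * measurableTypeR R -> R) n :
  (forall u, t <= u <= s -> measurable_fun D (G u)) ->
  measurable_fun D (fun p => G (grid n p.2) p).
Proof.
move=> mG; pose u k : R := t + k%:R / n.+1%:R.
have n0 : 0 < n.+1%:R :> R by rewrite ltr0n.
pose I k : set (measurableTypeR R) := `[t, s]%classic `&` `[u k, u k.+1[%classic.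
have mI k : measurable ([set: Om] `*` I k) by apply: measurableX => //; exact: measurableI.
have gridI k r : I k r -> grid n r = u k.
  rewrite /I /= !in_itv/= => -[/andP[tr rs] /andP[h1 h2]]; rewrite /grid /u.
  congr (t + _%:R / _); apply: truncn_def.
  by rewrite -ler_pdivrMr// -ltr_pdivlMr// lerBrDl ltrBlDl h1.
have -> : D = \bigcup_k ([set: Om] `*` I k).
  rewrite -setX_bigcupr; congr (_ `*` _); apply/seteqP; split => [r|r [k _ []//]].
  rewrite /= in_itv/= => /andP[tr rs]; exists (Num.truncn ((r - t) * n.+1%:R)) => //.
  split; rewrite /= in_itv/= ?tr//; apply/andP; split; first exact: grid_le.
  rewrite /u -ltrBlDl ltr_pdivlMr//; exact: truncnS_gt.
apply/measurable_fun_bigcup => // k.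
have [uks|suk] := leP (u k) s; last first.
  have -> : [set: Om] `*` I k = set0.
    rewrite -subset0 => -[w r] [_] [] /=; rewrite !in_itv/= => /andP[_ rs] /andP[ur _].
    by move: (le_lt_trans (le_trans ur rs) suk); rewrite ltxx.
  exact: measurable_fun_set0.
apply: (eq_measurable_fun (G (u k))).
  by move=> [w r]; rewrite inE => -[_ /= Ir]; rewrite (gridI k).
apply: (measurable_funS _ _ (mG (u k) _)) => //.
- exact: measurableX.
- by move=> [w r] [_ []].
- by rewrite uks lerDl divr_ge0.
Qed.

Lemma measurable_grid_lim (G : R -> Om * measurableTypeR R -> R) :
  (forall u, t <= u <= s -> measurable_fun D (G u)) ->
  (forall p, D p -> G (grid n p.2) p @[n --> \oo] --> G p.2 p) ->
  measurable_fun D (fun p => G p.2 p).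
Proof.
move=> mG cG; apply: (measurable_fun_cvg _ cG) => n.
exact: measurable_grid_comp.
Qed.

End grid.

(** * Positive contraction semigroups *)

Section contraction_semigroup_theory.
Context (R : realType) (H : preHilbertType R) (S : R -> H -> H).
Hypothesis S_semigroup : contraction_semigroup S.

Lemma semigroupDZ u (a : R) x y : 0 <= u -> S u (a *: x + y) = a *: S u x + S u y.
Proof. by move=> u0; have [lS _ _ _ _] := S_semigroup; exact: lS. Qed.

Lemma semigroupD u x y : 0 <= u -> S u (x + y) = S u x + S u y.
Proof. by move=> u0; have := semigroupDZ 1 x y u0; rewrite !scale1r. Qed.

Lemma semigroupB u x y : 0 <= u -> S u (x - y) = S u x - S u y.
Proof.
move=> u0; have := semigroupDZ (-1) y x u0.
by rewrite !scaleN1r addrC [RHS]addrC.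
Qed.

Lemma semigroupZ u (a : R) x : 0 <= u -> S u (a *: x) = a *: S u x.
Proof.
move=> u0; have S0 : S u 0 = 0 by have := semigroupB 0 0 u0; rewrite !subrr.
by have := semigroupDZ a x 0 u0; rewrite S0 !addr0.
Qed.

(** The summand 1 makes the constant positive, as [bochner_functional] requires. *)
Lemma semigroup_dot_le u x h : 0 <= u -> `|dot (S u x) h| <= (`|h| + 1) * `|x|.
Proof.
move=> u0; have [_ _ _ cS _] := S_semigroup.
apply: (le_trans (dot_le _ _)); rewrite mulrC; apply: ler_pM => //.
- by rewrite lerDl.
- exact: cS.
Qed.

Lemma continuous_semigroup_dot u h : 0 <= u -> continuous (fun x => dot (S u x) h).
Proof.
move=> u0 x; apply/cvgrPdist_lt => e e0.
have h1 : 0 < `|h| + 1 by rewrite ltr_wpDl.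
have d0 : 0 < e / (`|h| + 1) by rewrite divr_gt0.
apply: filterS (nbhsx_ballx x _ d0) => y; rewrite -ball_normE /= => xy.
rewrite -dotBl -semigroupB// (le_lt_trans (semigroup_dot_le _ _ u0))//.
by rewrite mulrC -ltr_pdivlMr.
Qed.

(** Since $S(s-v)=S(s-r)S(r-v)$, contractivity reduces the claim to $S(r-v)x\to x$. *)
Lemma semigroup_cvg (s r : R) (x : H) (v : nat -> R) :
  (forall n, v n <= r) -> r <= s -> v n @[n --> \oo] --> r ->
  S (s - v n) x @[n --> \oo] --> S (s - r) x.
Proof.
have [_ S0 SD cS Sr] := S_semigroup.
move=> vr rs cv; apply/cvgrPdist_lt => e e0.
have /cvgrPdist_lt/(_ _ e0) := Sr x.
rewrite near_withinE => /nbhs_ballP[dl /= dl0 hd].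
move/cvgrPdist_lt : cv => /(_ _ dl0); apply: filterS => n.
rewrite ger0_norm ?subr_ge0// => hn.
have -> : S (s - v n) x = S (s - r) (S (r - v n) x).
  by rewrite -SD ?subr_ge0// addrA subrK.
rewrite -semigroupB ?subr_ge0//.
apply: (le_lt_trans (cS _ _ _)); first by rewrite subr_ge0.
(* The limit at 0 is over strictly positive times, so [v n = r] is treated apart. *)
have := vr n; rewrite le_eqVlt => /predU1P[->|vrn].
  by rewrite subrr S0 subrr normr0.
apply: hd; last by rewrite subr_gt0.
by rewrite -ball_normE /= sub0r normrN ger0_norm ?subr_ge0.
Qed.

End contraction_semigroup_theory.

Section positive_semigroup.
Context d (U : measurableType d) (R : realType) (mu : {measure set U -> \bar R}).
Local Notation H := (L2 mu).
Context (S : R -> H -> H).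
Hypothesis S_semigroup : contraction_semigroup S.
Hypothesis S_positive : forall s x, 0 <= s -> L2_le 0 x -> L2_le 0 (S s x).

Lemma L2_le0E (x : H) : L2_le 0 x <-> `|L2_neg x| = 0.
Proof.
split=> [x0|]; last exact: L2_neg_eq0.
have : `|L2_neg x| ^+ 2 <= 0.
  by rewrite -dot_neg oppr_le0; apply: dot_ge0 => //; exact: L2_neg_ge0.
by rewrite le_eqVlt ltNge sqr_ge0 orbF sqrf_eq0 => /eqP.
Qed.

Lemma norm_L2_neg_le (x : H) : `|L2_neg x| <= `|x|.
Proof.
have [->|n0] := eqVneq (`|L2_neg x|) 0; first by [].
have np : 0 < `|L2_neg x| by rewrite lt0r n0 normr_ge0.
rewrite -(ler_pM2r np) -expr2 -dot_neg -dotNl -[`|x|]normrN.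
exact: (le_trans (ler_norm _) (dot_le _ _)).
Qed.

(* Adding [lam * (Y1 - Y2)] to the drift makes the nonlinearity nondecreasing,
   so that its negative part is controlled by that of [Y1 - Y2] alone. *)
Lemma drift_lower_bound (u lam : R) (beta : R -> R) (Y1 Y2 b1 b2 F1 F2 h : H) :
  0 <= u -> 0 <= lam ->
  (forall y z, `|beta y - beta z| <= lam * `|y - z|) ->
  {ae mu, forall xi, b1 xi = beta (Y1 xi)} ->
  {ae mu, forall xi, b2 xi = beta (Y2 xi)} ->
  L2_le F2 F1 -> unit_cone h ->
  0 <= (dot (S u (b1 + F1)) h - dot (S u (b2 + F2)) h) +
       lam * (dot (S u Y1) h - dot (S u Y2) h) + 2 * lam * `|L2_neg (Y1 - Y2)|.
Proof.
move=> u0 lam0 lip b1E b2E F21 [h0 h1].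
pose z : H := ((b1 + F1) - (b2 + F2)) + (lam *: (Y1 - Y2) + (2 * lam) *: L2_neg (Y1 - Y2)).
have z0 : L2_le 0 z.
  have e1 := L2_funD ((b1 + F1) - (b2 + F2)) (lam *: (Y1 - Y2) + (2 * lam) *: L2_neg (Y1 - Y2)).
  have e2 := L2_funB (b1 + F1) (b2 + F2).
  have e3 := L2_funD b1 F1; have e4 := L2_funD b2 F2.
  have e5 := L2_funD (lam *: (Y1 - Y2)) ((2 * lam) *: L2_neg (Y1 - Y2)).
  have e6 := L2_funZ lam (Y1 - Y2); have e7 := L2_funZ (2 * lam) (L2_neg (Y1 - Y2)).
  have e8 := L2_funB Y1 Y2; have e9 := L2_negE (Y1 - Y2); have e0 := @L2_fun0 _ U R mu.
  near=> xi.
  rewrite (near e0 xi)// (near e1 xi)// (near e2 xi)// (near e3 xi)// (near e4 xi)//.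
  rewrite (near e5 xi)// (near e6 xi)// (near e7 xi)// (near e9 xi)// (near e8 xi)//.
  rewrite (near b1E xi)// (near b2E xi)//.
  have F12 : F2 xi <= F1 xi by near: xi.
  have := lip (Y1 xi) (Y2 xi); rewrite ler_norml => /andP[l1 l2].
  set y1 := Y1 xi in l1 l2 *; set y2 := Y2 xi in l1 l2 *.
  (* If [y1 >= y2], the Lipschitz bound alone suffices. Otherwise it leaves $2\,lam\,(y_1-y_2)$,
     which the negative part with factor [2 * lam] offsets exactly. *)
  case: (leP (- (y1 - y2)) 0) => y0.
    by rewrite mulr0 addr0; move: l1; rewrite ger0_norm; [lra|lra].
  move: l1; rewrite ltr0_norm; last by lra.
  by move=> l1; rewrite -[2 * lam * _]mulrA; nra.
have : 0 <= dot (S u z) h by apply: dot_ge0 => //; exact: S_positive.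
rewrite /z (semigroupD S_semigroup)// (semigroupB S_semigroup)//.
rewrite (semigroupD S_semigroup (lam *: _))// !(semigroupZ S_semigroup)//.
rewrite (semigroupB S_semigroup Y1)// !(dotDl, dotZl, dotNl).
have : dot (S u (L2_neg (Y1 - Y2))) h <= `|L2_neg (Y1 - Y2)|.
  apply: (le_trans (ler_norm _)); apply: (le_trans (dot_le _ _)).
  have [_ _ _ cS _] := S_semigroup.
  by rewrite -[leRHS]mulr1; apply: ler_pM => //; exact: cS.
move=> k1 k2; apply: (le_trans k2); rewrite addrA lerD2l.
by rewrite ler_wpM2l// mulr_ge0.
Unshelve. all: by end_near. Qed.

End positive_semigroup.

(** * Comparison of mild solutions *)

Lemma measurable_fun_section d1 d2 (T1 : measurableType d1) (T2 : measurableType d2)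
    (R : realType) (A : set T2) (f : T1 * T2 -> R) (y : T2) :
  measurable A -> A y -> measurable_fun (setT `*` A) f ->
  measurable_fun setT (fun x => f (x, y)).
Proof.
move=> mA Ay mf; apply: (measurable_comp _ _ mf).
- exact: measurableX.
- by move=> _ [x _ <-].
- exact: measurable_pair2.
Qed.

Lemma measurable_fun_section2 d1 d2 (T1 : measurableType d1) (T2 : measurableType d2)
    (R : realType) (A : set T2) (f : T1 * T2 -> R) (x : T1) :
  measurable A -> measurable_fun (setT `*` A) f ->
  measurable_fun A (fun y => f (x, y)).
Proof.
move=> mA mf; apply: (measurable_comp _ _ mf).
- exact: measurableX.
- by move=> _ [y Ay <-].
- by apply: measurable_funTS; exact: measurable_pair1.
Qed.

Section comparison.
Context (R : realType) (Xi : hilbertType R) (dOm : measure_display)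
  (Om : measurableType dOm) (P : probability Om R).
Context d (U : measurableType d) (mu : {measure set U -> \bar R}).
Local Notation H := (L2 mu).
Local Notation leb := (@lebesgue_measure R).
Context (P_complete : measure_is_complete P).
Context (S : R -> H -> H) (S_semigroup : contraction_semigroup S).
Hypothesis S_positive : forall s x, 0 <= s -> L2_le 0 x -> L2_le 0 (S s x).
Context (t T : R) (W : R -> Xi -> Om -> R) (W_wiener : cylindrical_wiener P W t T).

Local Notation strip s := ([set: Om] `*` (`[t, s]%classic : set (measurableTypeR R))).

Lemma measurable_strip s : measurable (strip s).
Proof. by apply: measurableX. Qed.

Section dense_cone.
Context (D : nat -> H) (D_cone : forall i, unit_cone (D i))
  (D_dense : forall k (e : R), unit_cone k -> 0 < e -> exists i, `|k - D i| < e).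

Lemma measurable_norm_L2_neg (Y1 Y2 : Om -> R -> H) : t <= T ->
  prog_measurable P W t T (@borel H) Y1 -> prog_measurable P W t T (@borel H) Y2 ->
  measurable_fun (strip T) (fun p => `|L2_neg (Y1 p.1 p.2 - Y2 p.1 p.2)|).
Proof.
move=> tT mY1 mY2; apply: (measurability _ (RGenOInfty.measurableE R)).
move=> _ [_ [x ->] <-].
(* The functionals act on [Y1] and [Y2] separately, so that the difference is taken between real
   measurable functions. *)
rewrite (_ : _ `&` _ = \bigcup_i (strip T `&`
   (fun p => - (dot (Y1 p.1 p.2) (D i) - dot (Y2 p.1 p.2) (D i))) @^-1` `]x, +oo[)); last first.
  rewrite -setI_bigcupr; congr (_ `&` _); apply/seteqP; split => p /=.
    rewrite in_itv/= andbT => /(norm_L2_neg_dense D_cone D_dense)[i hi].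
    by exists i => //=; rewrite in_itv/= andbT -dotBl.
  move=> [i _ /=]; rewrite !in_itv/= !andbT -dotBl => hi.
  by apply/(norm_L2_neg_dense D_cone D_dense); exists i.
apply: bigcupT_measurable => i.
have mi : measurable_fun (strip T) (fun p => - (dot (Y1 p.1 p.2) (D i) - dot (Y2 p.1 p.2) (D i))).
  apply: measurableT_comp => //; apply: measurable_funB.
    exact: (prog_measurable_fun P_complete W_wiener tT mY1 (@continuous_dot _ _ (D i))).
  exact: (prog_measurable_fun P_complete W_wiener tT mY2 (@continuous_dot _ _ (D i))).
by apply: mi => //; exact: measurable_strip.
Qed.

(** The order amounts to the vanishing of a jointly measurable real function, so the exceptional set
    is measurable. This serves to use [f1 >= f2] along almost every path. *)
Lemma ae_L2_le (Y1 Y2 : Om -> R -> H) : t <= T ->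
  prog_measurable P W t T (@borel H) Y1 -> prog_measurable P W t T (@borel H) Y2 ->
  (forall s, t <= s <= T -> {ae P, forall w, L2_le (Y2 w s) (Y1 w s)}) ->
  {ae P, forall w, {ae leb, forall r, `[t, T]%classic r -> L2_le (Y2 w r) (Y1 w r)}}.
Proof.
move=> tT mY1 mY2 le21; apply: fubini_ae; last first.
  by move=> r; rewrite /= in_itv/=; exact: le21.
have mN := measurable_norm_L2_neg tT mY1 mY2.
have := mN (measurable_strip T) [set~ 0] (measurableC (measurable_set1 0)).
congr measurable; apply/seteqP; split => p /=.
  by move=> [[_ tp] n0]; split => // /L2_le_sub/L2_le0E.
move=> [tp nle]; split; first by split.
by move=> n0; apply: nle; apply/L2_le_sub/L2_le0E.
Qed.

End dense_cone.

(** * The tested equation for the difference of two mild solutions *)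

Section solutions.
Context (b : Om -> R -> H -> H) (beta : Om -> R -> R -> R) (lam : R) (lam0 : 0 <= lam).
Hypothesis beta_lip : forall w s y z, t <= s <= T ->
  `|beta w s y - beta w s z| <= lam * `|y - z|.
Hypothesis b_nemytskii : forall w s (x : H), t <= s <= T ->
    {ae mu, forall xi, b w s x xi = beta w s (x xi)}.
Context (f1 f2 : Om -> R -> H) (sigma : Om -> R -> Xi -> H) (x1 x2 : H)
  (X1 X2 : Om -> R -> H).
Hypothesis X1_mild : mild_solution P W t T S b f1 sigma x1 X1.
Hypothesis X2_mild : mild_solution P W t T S b f2 sigma x2 X2.

Definition drift1 w r := b w r (X1 w r) + f1 w r.
Definition drift2 w r := b w r (X2 w r) + f2 w r.

Definition tested_difference s h w r := dot (S (s - r) (X1 w r)) h - dot (S (s - r) (X2 w r)) h.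
Definition tested_datum s h := dot (S (s - t) x1) h - dot (S (s - t) x2) h.

(** A relation and not a function: [phi] is any integrable representative in time for this [w], with
    no measurability in [w]. *)
Definition tested_drift s h r w (phi : R -> R) := leb.-integrable `[t, r] (EFin \o phi) /\
  {ae leb, forall q, `[t, r]%classic q ->
     phi q = dot (S (s - q) (drift1 w q)) h - dot (S (s - q) (drift2 w q)) h}.

Lemma mild_difference s h r : t <= r -> r <= s -> s <= T ->
  {ae P, forall w, exists phi, tested_drift s h r w phi /\
     tested_difference s h w r = tested_datum s h + \int[leb]_(q in `[t, r]) phi q}.
Proof.
move=> tr rs sT; have rT := le_trans rs sT.
have trT : t <= r <= T by rewrite tr.
have sr0 : 0 <= s - r by rewrite subr_ge0.
apply: (ae_imp2 (X1_mild.2 r trT) (X2_mild.2 r trT)).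
move=> w [_ [J1 hJ1 E1]] [_ [J2 hJ2 E2]].
have [_ _ SD _ _] := S_semigroup.
have SE q x : q <= r -> S (s - r) (S (r - q) x) = S (s - q) x.
  by move=> qr; rewrite -SD ?subr_ge0// addrA subrK.
have hC : 0 < `|h| + 1 :> R by rewrite ltr_wpDl.
have lin a x y : dot (S (s - r) (a *: x + y)) h = a * dot (S (s - r) x) h + dot (S (s - r) y) h.
  by rewrite (semigroupDZ S_semigroup)// dotDZl.
have bnd x := semigroup_dot_le S_semigroup x h sr0.
have mI : measurable (`[t, r]%classic : set (measurableTypeR R)) by [].
have [phi1 [i1 p1 I1]] := bochner_functional mI lin hC bnd hJ1.
have [phi2 [i2 p2 I2]] := bochner_functional mI lin hC bnd hJ2.
exists (fun q => phi1 q - phi2 q); split.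
  split; first exact: (integrableB _ i1 i2).
  apply: (ae_imp2 p1 p2) => q h1 h2 qtr; rewrite h1// h2//.
  by move: qtr; rewrite /= in_itv/= => /andP[_ qr]; rewrite !SE.
rewrite RintegralB// I1 I2 /tested_difference /tested_datum E1 E2.
(* Both equations contain the same vector [stochastic_integral] at time [r], which cancels in the
   difference. *)
rewrite !(semigroupD S_semigroup)// !SE// !dotDl.
by ring.
Qed.

(** Any two representatives agree almost everywhere on $[t,r]$, so one [phi] on $[t,s]$ serves every
    [r]. Quantifying over [phi] inside keeps the null event independent of it. *)
Lemma mild_difference_repr s h r : t <= r -> r <= s -> s <= T ->
  {ae P, forall w, forall phi, tested_drift s h s w phi ->
     tested_difference s h w r = tested_datum s h + \int[leb]_(q in `[t, r]) phi q}.
Proof.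
move=> tr rs sT; apply: (ae_imp (mild_difference h tr rs sT)).
move=> w [phir [[ir pr] ->]] phi [is_ ps]; congr (_ + _).
have is_r : leb.-integrable `[t, r] (EFin \o phi).
  by apply: integrableS is_ => //; apply: subset_itvl; rewrite bnd_simp.
apply: ae_eq_Rintegral => //.
- by have /integrableP[/measurable_EFinP] := ir.
- by have /integrableP[/measurable_EFinP] := is_r.
apply: (ae_imp2 pr ps) => q h1 h2 qtr; rewrite h1// h2//.
by move: qtr; rewrite /= !in_itv/= => /andP[-> /le_trans]; apply.
Qed.

Lemma measurable_semigroup_dot (X : Om -> R -> H) s u h : u <= s -> s <= T -> t <= u ->
  prog_measurable P W t T (@borel H) X ->
  measurable_fun (strip s) (fun p => dot (S (s - u) (X p.1 p.2)) h).
Proof.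
move=> us sT tu mX; have tT := le_trans tu (le_trans us sT).
have su0 : 0 <= s - u by rewrite subr_ge0.
have := prog_measurable_fun P_complete W_wiener tT mX (@continuous_semigroup_dot _ _ _ S_semigroup _ h su0).
apply: measurable_funS; first exact: measurable_strip.
by move=> [w r] [_ /= tr]; split => //; apply: subset_itvl tr; rewrite bnd_simp.
Qed.

(** Only the semigroup parameter is frozen on the grid, so the limit rests on strong continuity of
    [S]; [X] need not be continuous in time. *)
Lemma measurable_semigroup_dot_time (X : Om -> R -> H) s h : t <= s -> s <= T ->
  prog_measurable P W t T (@borel H) X ->
  measurable_fun (strip s) (fun p => dot (S (s - p.2) (X p.1 p.2)) h).
Proof.
move=> ts sT mX.
apply: (@measurable_grid_lim _ _ _ _ _ (fun u p => dot (S (s - u) (X p.1 p.2)) h)).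
  by move=> u /andP[tu us]; exact: measurable_semigroup_dot.
move=> [w r] [_]; rewrite /= in_itv/= => /andP[tr rs].
apply: (continuous_cvg _ (@continuous_dot _ _ h _)).
apply: (semigroup_cvg S_semigroup) => //; first by move=> n; exact: grid_le.
exact: grid_cvg.
Qed.

Lemma measurable_tested_difference s h : t <= s -> s <= T ->
  measurable_fun (strip s) (fun p => tested_difference s h p.1 p.2).
Proof.
move=> ts sT; apply: measurable_funB; apply: measurable_semigroup_dot_time => //.
- exact: X1_mild.1.
- exact: X2_mild.1.
Qed.

Lemma measurable_tested_difference_grid s h n : t <= s -> s <= T ->
  measurable_fun (strip s) (fun p => tested_difference s h p.1 (grid t n p.2)).
Proof.
move=> ts sT.
apply: (@measurable_grid_comp _ _ _ _ _ (fun u p => tested_difference s h p.1 u)) => u /andP[tu us].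
have mu_ : measurable_fun setT (fun w => tested_difference s h w u).
  apply: (@measurable_fun_section _ _ Om (measurableTypeR R) R `[t, s]%classic
    (fun p => tested_difference s h p.1 p.2)) => //.
    by rewrite /= in_itv/= tu.
  exact: measurable_tested_difference.
apply: measurable_funTS; exact: (measurableT_comp mu_ measurable_fst).
Qed.

(* The exceptional null set of [mild_difference_repr] depends on [r]. Both
   [tested_difference s h] and the limit [Psi] of its values at the grid points
   below [r] are jointly measurable, and almost surely the grid points, which are
   countably many, determine the continuous right-hand side. *)
Lemma mild_difference_ae s h : t <= s -> s <= T ->
  {ae P, forall w, exists phi, [/\ tested_drift s h s w phi,
     {ae leb, forall r, `[t, s]%classic r ->
        tested_difference s h w r = tested_datum s h + \int[leb]_(q in `[t, r]) phi q} &
     tested_difference s h w s = tested_datum s h + \int[leb]_(q in `[t, s]) phi q]}.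
Proof.
move=> ts sT.
pose Psi w r := limn_esup (fun n => (tested_difference s h w (grid t n r))%:E).
pose G w := forall n r, t <= r <= s -> forall phi, tested_drift s h s w phi ->
  tested_difference s h w (grid t n r) = tested_datum s h + \int[leb]_(q in `[t, (grid t n r)]) phi q.
have aG : {ae P, forall w, G w}.
  have : {ae P, forall w, forall n k, let u := t + k%:R / n.+1%:R in u <= s ->
     forall phi, tested_drift s h s w phi ->
     tested_difference s h w u = tested_datum s h + \int[leb]_(q in `[t, u]) phi q}.
    apply: ae_foralln => n; apply: ae_foralln => k /=; set u := t + _.
    have [us|us] := leP u s; last by apply: aeW => w.
    have tu : t <= u by rewrite lerDl divr_ge0.
    by apply: (ae_imp (mild_difference_repr h tu us sT)).
  move=> hG; apply: (ae_imp hG) => w hw n r /andP[tr rs] phi hphi.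
  apply: (hw n (Num.truncn ((r - t) * n.+1%:R))) => //.
  exact: le_trans (grid_le n tr) rs.
(* On the single event [G], continuity of the primitive carries the identity from the grid points to
   every [r]. *)
have PsiE w r phi : G w -> tested_drift s h s w phi -> t <= r <= s ->
    Psi w r = (tested_datum s h + \int[leb]_(q in `[t, r]) phi q)%:E.
  move=> Gw hphi /andP[tr rs].
  have cv : (tested_difference s h w (grid t n r))%:E @[n --> \oo] -->
      (tested_datum s h + \int[leb]_(q in `[t, r]) phi q)%:E.
    apply: cvg_EFin; first exact: nearW.
    under eq_fun do rewrite /= (Gw _ r _ phi hphi) ?tr//.
    apply: cvgD; first exact: cvg_cst.
    apply/cvgrPdist_lt => e e0.
    have rts : `[t, s]%classic r by rewrite /= in_itv/= tr.
    have [dl dl0 hd] := within_continuous_dist (parameterized_integral_continuous ts hphi.1) rts e0.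
    have /cvgrPdist_lt/(_ _ dl0) := @grid_cvg _ t _ tr.
    apply: filterS => n; apply: hd.
    by rewrite /= in_itv/= grid_ge (le_trans (grid_le n tr) rs).
  by rewrite /Psi is_cvg_limn_esupE ?(cvg_lim _ cv)//; apply/cvg_ex; eexists; exact: cv.
have aPsi : {ae P, forall w, {ae leb, forall r, `[t, s]%classic r ->
    (tested_difference s h w r)%:E = Psi w r}}.
  apply: fubini_ae; last first.
    move=> r; rewrite /= in_itv/= => trs; have /andP[tr rs] := trs.
    have a1 := mild_difference_repr h tr rs sT.
    (* Taken at time [s] to provide some [phi]: both [a1] and [G] are conditional on one. *)
    have a2 := mild_difference h ts (lexx s) sT.
    apply: filterS3 aG a1 a2 => w Gw h1 [phi [hphi _]].
    by rewrite (h1 phi)// (PsiE w r phi).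
  have mD := measurable_strip s.
  have mE : measurable_fun (strip s) (fun p => (tested_difference s h p.1 p.2)%:E).
    by apply/measurable_EFinP; exact: measurable_tested_difference.
  have mPsi : measurable_fun (strip s) (fun p => Psi p.1 p.2).
    apply: measurable_fun_limn_esup => n; apply/measurable_EFinP.
    exact: measurable_tested_difference_grid.
  have := measurable_neqe mD mE mPsi.
  congr measurable; apply/seteqP; split => p /=.
    by move=> [[_ tp] /eqP].
  by move=> [tp /eqP].
have a2 := mild_difference h ts (lexx s) sT.
apply: filterS3 aG aPsi a2 => w Gw h1 [phi [hphi hs]].
exists phi; split => //.
apply: (ae_imp h1) => r hr trs; have := hr trs.
by rewrite (PsiE w r phi)// => -[].
Qed.


(** * Ordered data: the integral inequality for the negative part *)

Section order.
Hypothesis f1_prog : prog_measurable P W t T (@borel H) f1.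
Hypothesis f2_prog : prog_measurable P W t T (@borel H) f2.
Hypothesis le_x : L2_le x2 x1.
Hypothesis le_f : forall s, t <= s <= T -> {ae P, forall w, L2_le (f2 w s) (f1 w s)}.
Context (D : nat -> H) (D_cone : forall i, unit_cone (D i))
  (D_dense : forall k (e : R), unit_cone k -> 0 < e -> exists i, `|k - D i| < e).

Definition neg_norm w r := `|L2_neg (X1 w r - X2 w r)|.

Lemma integrable_norm_mild (f : Om -> R -> H) (x : H) (X : Om -> R -> H) : t <= T ->
  mild_solution P W t T S b f sigma x X ->
  {ae P, forall w, leb.-integrable `[t, T] (fun r => `|X w r|%:E)}.
Proof.
move=> tT [mX X_mild]; have tTT : t <= T <= T by rewrite tT lexx.
apply: (ae_imp (X_mild T tTT)) => w [ilt _].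
have mn : measurable_fun `[t, T] (fun r => `|X w r|).
  apply: (@measurable_fun_section2 _ _ Om (measurableTypeR R) R `[t, T]%classic
    (fun p => `|X p.1 p.2|)) => //.
  exact: (prog_measurable_fun P_complete W_wiener tT mX (@norm_continuous _ _)).
apply/integrableP; split; first exact/measurable_EFinP.
have hs0 (F : Xi -> H) : (0 <= hs_normsq F)%E.
  by apply: esum_ge0 => e _; rewrite lee_fin exprn_ge0.
(* The full integrand in the definition of a mild solution is not known to be measurable; only its
   first summand is kept. *)
apply: le_lt_trans ilt; apply: le_integral_nonmeasurable => //.
- by apply: measurableT_comp => //; exact/measurable_EFinP.
- by move=> r _; apply: adde_ge0 => //; rewrite lee_fin addr_ge0.
apply: aeW => r _; rewrite abse_EFin normr_id EFinD -addeA leeDl// adde_ge0//.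
Qed.

Lemma integrable_neg_norm : t <= T -> {ae P, forall w, leb.-integrable `[t, T] (EFin \o neg_norm w)}.
Proof.
move=> tT.
apply: (ae_imp2 (integrable_norm_mild tT X1_mild) (integrable_norm_mild tT X2_mild)) => w i1 i2.
have mI : measurable (`[t, T]%classic : set (measurableTypeR R)) by [].
apply: le_integrable (integrableD mI i1 i2) => //.
  apply/measurable_EFinP.
  apply: (@measurable_fun_section2 _ _ Om (measurableTypeR R) R `[t, T]%classic
    (fun p => neg_norm p.1 p.2)) => //.
  exact: (measurable_norm_L2_neg D_cone D_dense tT X1_mild.1 X2_mild.1).
move=> r _ /=; rewrite lee_fin normr_id [leRHS]ger0_norm ?addr_ge0//.
by rewrite (le_trans (norm_L2_neg_le _))// ler_normB.
Qed.

Lemma dot_difference_bound s h : t <= s -> s <= T -> unit_cone h ->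
  {ae P, forall w, - dot (X1 w s - X2 w s) h <= 2 * lam * \int[leb]_(r in `[t, s]) neg_norm w r}.
Proof.
move=> ts sT hh; have tT := le_trans ts sT.
have a1 := ae_L2_le D_cone D_dense tT f1_prog f2_prog le_f.
apply: filterS3 (integrable_neg_norm tT) a1 (mild_difference_ae h ts sT) => w iN hf [phi [[iphi phiE] hM Ms]].
have [_ S0 _ _ _] := S_semigroup.
have iNs : leb.-integrable `[t, s] (EFin \o neg_norm w).
  by apply: integrableS iN => //; apply: subset_itvl; rewrite bnd_simp.
have mI : measurable (`[t, s]%classic : set (measurableTypeR R)) by [].
have iNk : leb.-integrable `[t, s] (fun r => (2 * lam * neg_norm w r)%:E).
  by have := integrableZl mI (2 * lam) iNs; apply: eq_integrable => // r _ /=; rewrite EFinM.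
(* Absorbing the error term into the integrand gives an inequality of the form treated by
   [linear_comparison], with initial value [tested_datum s h]. *)
pose psi r := phi r + 2 * lam * neg_norm w r.
have ipsi : leb.-integrable `[t, s] (EFin \o psi).
  by have := integrableD mI iphi iNk; apply: eq_integrable => // r _ /=; rewrite EFinD.
have psiE r : r <= s -> \int[leb]_(q in `[t, r]) psi q =
    \int[leb]_(q in `[t, r]) phi q + 2 * lam * \int[leb]_(q in `[t, r]) neg_norm w q.
  move=> rs; have sub : `[t, r]%classic `<=` `[t, s]%classic by apply: subset_itvl; rewrite bnd_simp.
  have mIr : measurable (`[t, r]%classic : set (measurableTypeR R)) by [].
  rewrite RintegralD//; last 2 first.
  - exact: (integrableS mI mIr sub iphi).
  - exact: (integrableS mI mIr sub iNk).
  by rewrite RintegralZl//; exact: (integrableS mI mIr sub iNs).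
have c0 : 0 <= tested_datum s h.
  rewrite /tested_datum -dotBl -(semigroupB S_semigroup) ?subr_ge0//.
  apply: dot_ge0; last by case: hh.
  by apply: S_positive; [rewrite subr_ge0|exact: ((L2_le_sub _ _).1 le_x)].
have : 0 <= tested_datum s h + \int[leb]_(q in `[t, s]) psi q.
  apply: (@linear_comparison _ _ _ _ _ lam) => //.
  have hf' : {ae leb, forall r, `[t, s]%classic r -> L2_le (f2 w r) (f1 w r)}.
    by apply: (ae_imp hf) => r + trs; apply; apply: subset_itvl trs; rewrite bnd_simp.
  have phiM := ae_imp2 phiE hM (fun r p q => conj p q).
  apply: (ae_imp2 hf' phiM) => r fr [phir Mr] trs.
  have /andP[tr rs] : t <= r <= s by move: trs; rewrite /= in_itv.
  have trT : t <= r <= T by rewrite tr (le_trans rs).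
  rewrite psiE// addrA -Mr// /psi phir//.
  have sr0 : 0 <= s - r by rewrite subr_ge0.
  have := drift_lower_bound S_semigroup S_positive sr0 lam0 (fun y z => beta_lip w y z trT)
    (b_nemytskii w (X1 w r) trT) (b_nemytskii w (X2 w r) trT) (fr trs) hh.
  rewrite -/(drift1 w r) -/(drift2 w r) -/(neg_norm w r) -/(tested_difference s h w r) => k1.
  (* Replacing the primitive of [phi] by that of [psi] adds this term, which has the favourable
     sign. *)
  have k2 : 0 <= lam * (2 * lam * \int[leb]_(q in `[t, r]) neg_norm w q).
    by rewrite !mulr_ge0//; apply: Rintegral_ge0 => q _; exact: normr_ge0.
  by rewrite mulrDr addrACA addrA addr_ge0.
rewrite psiE// addrA -Ms /tested_difference subrr !S0 -dotBl addrC => k.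
by rewrite -subr_ge0 opprK.
Qed.

Lemma neg_norm_bound s : t <= s -> s <= T ->
  {ae P, forall w, neg_norm w s <= 2 * lam * \int[leb]_(r in `[t, s]) neg_norm w r}.
Proof.
move=> ts sT.
have := ae_foralln (fun i => dot_difference_bound ts sT (D_cone i)).
move=> h; apply: (ae_imp h) => w hw; rewrite leNgt; apply/negP.
move=> /(norm_L2_neg_dense D_cone D_dense)[i].
by rewrite ltNge hw.
Qed.

(** The primitive of [neg_norm] is jointly measurable as a partial Tonelli integral: on triples it
    is the integral over $q$ of $1_{t\le q\le r}N(\omega,q)$, with $N$ extended by 0 outside the
    strip. *)
Lemma measurable_neg_norm_bound : t <= T -> measurable
  ([set p | `[t, T]%classic p.2 /\
     ~ neg_norm p.1 p.2 <= 2 * lam * \int[leb]_(r in `[t, p.2]) neg_norm p.1 r] : set (Om * measurableTypeR R)).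
Proof.
move=> tT.
have mN := measurable_norm_L2_neg D_cone D_dense tT X1_mild.1 X2_mild.1.
have mD := measurable_strip T.
pose Nt : Om * measurableTypeR R -> R := (fun p => neg_norm p.1 p.2) \_ (strip T).
have mNt : measurable_fun setT Nt by apply/(measurable_restrictT _ mD).
pose f (p : (Om * measurableTypeR R) * measurableTypeR R) : \bar R :=
  (if (t <= p.2) && (p.2 <= p.1.2) then Nt (p.1.1, p.2) else 0)%:E.
have mf : measurable_fun setT f.
  apply/measurable_EFinP; apply: measurable_fun_ifT => //.
    apply: measurable_and; apply: measurable_fun_ler => //.
    exact: (measurableT_comp measurable_snd measurable_fst).
  apply: (measurableT_comp mNt); apply/measurable_fun_pairP; split.
    exact: (measurableT_comp measurable_fst measurable_fst).
  exact: measurable_snd.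
have f0 p : (0 <= f p)%E.
  rewrite lee_fin; case: ifP => // _; rewrite /Nt /patch.
  by case: ifP => // _; rewrite /neg_norm.
have mI := measurable_fun_fubini_tonelli_F (m2 := leb) f mf f0.
have IE p : strip T p -> \int[leb]_(r in `[t, p.2]) neg_norm p.1 r = fine (fubini_F leb f p).
  move=> [_ /=]; rewrite in_itv/= => /andP[tp pT].
  rewrite /Rintegral integral_mkcond /fubini_F; congr fine.
  apply: eq_integral => r _; rewrite /patch /f /Nt /patch /=.
  rewrite mem_setE in_itv/=; case: ifP => // /andP[tr rp].
  by rewrite mem_set//; split => //=; rewrite in_itv/= tr (le_trans rp pT).
have mJ : measurable_fun (strip T) (fun p => 2 * lam * fine (fubini_F leb f p)).
  apply: measurable_funM => //; apply: measurableT_comp => //; exact: measurable_funTS.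
have mlt := measurable_fun_ltr mJ mN.
have := mlt mD [set true] I; congr measurable; apply/seteqP; split => p /=.
  by move=> [tp]; rewrite -IE// ltNge => /negP np; case: tp.
move=> [tp np]; have stp : strip T p by [].
by split => //; rewrite -IE// ltNge; apply/negP.
Qed.

Lemma mild_comparison s : t <= s <= T -> {ae P, forall w, L2_le (X2 w s) (X1 w s)}.
Proof.
move=> /andP[ts sT]; have tT := le_trans ts sT.
have hN : {ae P, forall w, {ae leb, forall r, `[t, T]%classic r ->
    neg_norm w r <= 2 * lam * \int[leb]_(q in `[t, r]) neg_norm w q}}.
  apply: fubini_ae; first exact: measurable_neg_norm_bound.
  by move=> r; rewrite /= in_itv/= => /andP[tr rT]; exact: neg_norm_bound.
(* Gronwall uses the bound at almost every time and makes the integral vanish; the bound at the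
   given [s] then yields the order at [s] itself. *)
apply: filterS3 (integrable_neg_norm tT) hN (neg_norm_bound ts sT) => w iN Nae Ns.
have K0 : 0 <= 2 * lam by rewrite mulr_ge0.
have N0 : \int[leb]_(q in `[t, T]) neg_norm w q = 0.
  exact: (gronwall_zero tT K0 iN (fun r => normr_ge0 _) Nae).
have Ns0 : \int[leb]_(q in `[t, s]) neg_norm w q <= 0.
  rewrite -N0 (Rintegral_itv_split iN ts sT) lerDl.
  by apply: Rintegral_ge0 => q _; exact: normr_ge0.
apply/L2_le_sub/L2_le0E/eqP; rewrite eq_le normr_ge0 andbT.
by rewrite (le_trans Ns)// mulr_ge0_le0.
Qed.

End order.
End solutions.
End comparison.

(** The points [D i] may lie outside [K]. For each [i] and [n] a point of [K] within $1/(n+1)$ of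
    [D i] is chosen when there is one, and [k0] otherwise. *)
Lemma dense_sequence_subset (R : realType) (V : normedModType R) (D : nat -> V) (K : set V) :
  (forall z (e : R), 0 < e -> exists i, `|z - D i| < e) -> K !=set0 ->
  exists2 D' : nat -> V, (forall i, K (D' i)) &
    forall k (e : R), K k -> 0 < e -> exists i, `|k - D' i| < e.
Proof.
move=> hD [k0 Kk0].
pose near_D (p : nat * nat) := [set k | K k /\ `|k - D p.1| < p.2.+1%:R^-1].
pose C p := xget k0 (near_D p).
have KC p : K (C p) by rewrite /C; case: xgetP => // k -> [].
exists (fun i => odflt k0 (omap C (unpickle i))).
  by move=> i; case: unpickle => //= p; exact: KC.
move=> k e Kk e0; pose n := Num.truncn (2 / e).
have n0 : 0 < n.+1%:R^-1 :> R by rewrite invr_gt0 ltr0n.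
have ne : n.+1%:R^-1 < e / 2.
  rewrite -[e / 2]invrK ltf_pV2 ?posrE ?invr_gt0 ?divr_gt0// invf_div.
  exact: truncnS_gt.
have [i hi] := hD k _ n0.
exists (pickle (i, n)); rewrite pickleK /= /C.
case: xgetP => [k' _ [_ hk']|/(_ k)[]//].
rewrite (le_lt_trans (ler_distD (D i) _ _))// [e]splitr ltrD//.
  exact: lt_trans ne.
by rewrite distrC; exact: lt_trans ne.
Qed.

Theorem theorem3p22
  (R : realType) (d : nat) (O : set 'rV[R]_d.+1)
  (O_open : open O) (O_connected : connected O) (O_nonempty : O !=set0)
  (Xi : hilbertType R) (Xi_separable : exists2 Q : set Xi, countable Q & dense Q)
  (disp : measure_display) (Omega : measurableType disp)
  (P : probability Omega R) (P_complete : measure_is_complete P)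
  (DA : set (L2_on O)) (A : L2_on O -> L2_on O) (S : R -> L2_on O -> L2_on O)
  (A_linear : linear_operator DA A) (A_dense : dense DA)
  (A_maxdiss : maximal_dissipative DA A)
  (S_semigroup : contraction_semigroup S) (A_generates_S : generates DA A S)
  (S_positive : forall s x, 0 <= s -> L2_le 0 x -> L2_le 0 (S s x))
  (t T : R) (t_ge0 : 0 <= t) (t_lt_T : t < T)
  (W : R -> Xi -> Omega -> R) (W_wiener : cylindrical_wiener P W t T)
  (bb : Omega -> R -> R -> R) (C_L : R)
  (bb_measurable :
    measurable_on ((setT `*` `[t, T]) `*` setT)
      (product_sigma (setT `*` `[t, T]) setT (prog P W t T) (@borel R))
      (@borel R) (fun p : (Omega * R) * R => bb p.1.1 p.1.2 p.2))
  (bb_lipschitz : forall w s (x1 x2 : R), t <= s <= T ->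
    `|bb w s x1 - bb w s x2| <= C_L * `|x1 - x2|)
  (bb0_L1 : {ae P, forall w,
    (\int[lebesgue_measure]_(s in `[t, T]) `|bb w s 0|%:E < +oo)%E})
  (b : Omega -> R -> L2_on O -> L2_on O)
  (b_nemytskii : forall w s (x : L2_on O), t <= s <= T ->
    {ae lebesgue_measure_on O, forall xi, b w s x xi = bb w s (x xi)})
  (f1 f2 : Omega -> R -> L2_on O)
  (f1_prog : prog_measurable P W t T (@borel (L2_on O)) f1)
  (f2_prog : prog_measurable P W t T (@borel (L2_on O)) f2)
  (f1_L1 : {ae P, forall w,
    (\int[lebesgue_measure]_(s in `[t, T]) `|f1 w s|%:E < +oo)%E})
  (f2_L1 : {ae P, forall w,
    (\int[lebesgue_measure]_(s in `[t, T]) `|f2 w s|%:E < +oo)%E})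
  (sigma : Omega -> R -> Xi -> L2_on O)
  (sigma_hs : forall w s, t <= s <= T -> hilbert_schmidt (sigma w s))
  (sigma_prog : prog_measurable P W t T (@hs_borel R Xi (L2_on O)) sigma)
  (sigma_L2 : {ae P, forall w,
    (\int[lebesgue_measure]_(s in `[t, T]) hs_normsq (sigma w s) < +oo)%E})
  (x1 x2 : L2_on O) (X1 X2 : Omega -> R -> L2_on O)
  (X1_mild : mild_solution P W t T S b f1 sigma x1 X1)
  (X2_mild : mild_solution P W t T S b f2 sigma x2 X2)
  (le_x : L2_le x2 x1)
  (le_f : forall s, t <= s <= T -> {ae P, forall w, L2_le (f2 w s) (f1 w s)}) :
  forall s, t <= s <= T -> {ae P, forall w, L2_le (X2 w s) (X1 w s)}.
Proof.
have [D0 D0_dense] := L2_on_separable O.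
have cone0 : @unit_cone _ _ _ (lebesgue_measure_on O) !=set0.
  by exists 0; split; [apply: aeW => xi|rewrite normr0].
have [D D_cone D_dense] := dense_sequence_subset D0_dense cone0.
(* [C_L] comes without a sign; its absolute value is a nonnegative Lipschitz constant. *)
have lip w s y z : t <= s <= T -> `|bb w s y - bb w s z| <= `|C_L| * `|y - z|.
  move=> ts; apply: (le_trans (bb_lipschitz w s y z ts)).
  by rewrite ler_wpM2r// ler_norm.
exact: (mild_comparison P_complete S_semigroup S_positive W_wiener (normr_ge0 C_L)
  lip b_nemytskii X1_mild X2_mild f1_prog f2_prog le_x le_f D_cone D_dense).
Qed.
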